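(* Let $C$ be a rational curve with one unibranch singularity at $p$, with semigroup $\Gamma=\{\gamma_0<\gamma_1<\gamma_2<\cdots\}$ ($\gamma_0=0$, $\Gamma\neq\mathbb{N}$). For each integer $N>\operatorname{c.i.}(\Gamma)$ let $C_\Gamma\subset\mathbb{P}^N$ be the (closure of the) image of the map $t\mapsto(1,t^{\gamma_1},t^{\gamma_2},\ldots,t^{\gamma_N})$, and let $w^*=(w_0^*,\ldots,w_N^* )\in\mathbb{R}^{N+1}$ be the weight vector of the worst 1-PS of the Chow point $[C_\Gamma]$ in the diagonal maximal torus, scaled by the positive real number for which $\sum_{i=0}^N a_{i+1}w_i^*=\|w^*\|^2$. Then there exist an integer $N_0$ and an integer $\ell$, both depending only on $\Gamma$, such that for all $N\ge N_0$ the coordinates $w_0^*,\ldots,w_{\ell-1}^*$ are constant with respect to $N$, and the coordinates $w_\ell^*,\ldots,w_N^*$ are given by $$w_i^*=mi+b,\qquad m=-\frac{6}{(N-\ell+1)(N-\ell+2)},\qquad b=2+\frac{2(N+2\ell-1)}{(N-\ell+1)(N-\ell+2)}.$$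
   Context: Semigroup. $\mathbb{N}=\{0,1,2,\dots\}$. The semigroup $\Gamma\subset\mathbb{N}$ of a unibranch singularity $p\in C$ is the set of valuations $\nu_p(f)$ of (nonzero) $f\in\mathcal{O}_{C,p}$; it is a numerical semigroup (a submonoid of $\mathbb{N}$ with finite complement), and $\Gamma\ne\mathbb{N}$ as $p$ is singular. $\operatorname{cond}(\Gamma)$ is the least integer $c$ with $\{n\in\mathbb{N}:n\ge c\}\subset\Gamma$, and $\operatorname{c.i.}(\Gamma)$ is the index with $\gamma_{\operatorname{c.i.}(\Gamma)}=\operatorname{cond}(\Gamma)$. Chow points. For an irreducible $X\subset\mathbb{P}^{n-1}$ of dimension $k-1$ and degree $d$, the codimension-$k$ linear subspaces $L\subset\mathbb{P}^{n-1}$ meeting $X$ form an irreducible hypersurface in the Grassmannian, defined (up to scalar) by a form $R_X$ of degree $d$ in the brackets $[i_1\cdots i_k]$ (the $k\times k$ minors of the matrix of coefficients of $k$ linear forms cutting out $L$). The Chow point is $[X]=[R_X]$. $\operatorname{GL}_n$ acts on the space of such forms, with weights for the diagonal torus $T$ such that the bracket coordinate $[i_1\cdots i_k]$ has weight $e_{i_1}+\cdots+e_{i_k}$ (so the weight polytope of $[X]$ is its Chow polytope in the sense of Gelfand–Kapranov–Zelevinsky). Here $n=N+1$, $k=2$. Worst 1-PS. For a 1-parameter subgroup $\lambda$ of $\operatorname{GL}_{N+1}$ acting linearly on a vector space, with $x$ decomposed into weight components $x_i$, the Hilbert–Mumford function is $\mu(x,\lambda)=\min\{i: x_i\ne0\}$.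 If $\lambda$ is conjugate to $t\mapsto\operatorname{diag}(t^{w_0},\dots,t^{w_N})$ put $\|\lambda\|=(\sum w_i^2)^{1/2}$. A (nontrivial) $\lambda^*$ is a worst 1-PS for $x$ if $\mu(x,\lambda^* )/\|\lambda^*\|=\sup_\lambda\mu(x,\lambda)/\|\lambda\|$. For $\lambda(t)=\operatorname{diag}(t^{w_0},\dots,t^{w_N})$ in $T$, the vector $w=(w_0,\dots,w_N)$ is its weight vector. Weight vectors of worst 1-PS are considered up to positive real scaling; the worst 1-PS of $[C_\Gamma]$ in $T$ is unique up to such scaling. The vector $a=(a_1,\dots,a_{N+1})$ used to fix the scaling: $a_1=\gamma_1$, $a_i=\gamma_i-\gamma_{i-2}$ for $2\le i\le N$, $a_{N+1}=1$. *)

(* Defs.v *)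
From mathcomp Require Import all_boot all_order all_algebra.
From mathcomp Require Import classical_sets reals.
From mathcomp Require Import mpoly.

Set Implicit Arguments.
Unset Strict Implicit.
Unset Printing Implicit Defensive.

Import Order.TTheory GRing.Theory Num.Theory.

Local Open Scope ring_scope.

Section Semigroup.
Local Open Scope nat_scope.

Definition numerical_semigroup (G : pred nat) : Prop :=
  [/\ G 0,
      forall m n, G m -> G n -> G (m + n)
    & exists c, forall n, c <= n -> G n].

(* gamma_0 < gamma_1 < ... lists the elements of G. *)
Definition enumerates (G : pred nat) (gamma : nat -> nat) : Prop :=
  {homo gamma : i j / i < j} /\ (forall n, G n <-> exists i, gamma i = n).

Definition is_conductor (G : pred nat) (c : nat) : Prop :=
  (forall n, c <= n -> G n) /\
  (forall c', (forall n, c' <= n -> G n) -> c <= c').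

(* Indexed from 1, that is, by 1 <= j <= N + 1. *)
Definition avec (gamma : nat -> nat) (N j : nat) : nat :=
  if j == 1 then gamma 1
  else if j == N.+1 then 1
  else gamma j - gamma (j - 2).

End Semigroup.

Section ChowForm.
Variables (k : closedFieldType) (n : nat).

(* A pair of linear forms on k^n is a 2 x n matrix of coefficients; the
   variables of {mpoly k[2 * n]} are the entries of the generic such matrix. *)
Definition coef_mx : 'M[{mpoly k[2 * n]}]_(2, n) :=
  \matrix_(i, j) 'X_(mxvec_index i j).

(* [ij], as the minor of coef_mx on columns i and j. *)
Definition bracket (i j : 'I_n) : {mpoly k[2 * n]} :=
  coef_mx 0 i * coef_mx 1 j - coef_mx 0 j * coef_mx 1 i.

Definition subst_mx (p q : nat) (S : comNzRingType)
    (M : 'M[{mpoly S[q]}]_(p, n)) (F : {mpoly S[p * n]}) : {mpoly S[q]} :=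
  F \mPo [tuple mxvec M 0 i | i < p * n].

Definition eval_mx (F : {mpoly k[2 * n]}) (A : 'M[k]_(2, n)) : k :=
  F.@[fun i => mxvec A 0 i].

Definition bracket_form (d : nat) (F : {mpoly k[2 * n]}) : Prop :=
  exists2 Q : {mpoly k[n * n]},
    Q \is d.-homog & F = subst_mx (\matrix_(i, j) bracket i j) Q.

Definition irreducible_mpoly (F : {mpoly k[2 * n]}) : Prop :=
  [/\ F != 0, F \isn't a GRing.unit
    & forall P Q, F = P * Q -> P \is a GRing.unit \/ Q \is a GRing.unit].

(* X is a projective variety of dimension 1, given by the homogeneous
   coordinate vectors of its points.  A matrix A of rank 2 represents the
   codimension 2 subspace L = ker A.  Irreducibility makes F the reduced
   equation of the hypersurface of all L meeting X, hence unique up to a scalar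
   and of degree d = deg X in the brackets. *)
Definition is_chow_form (X : set 'cV[k]_n) (F : {mpoly k[2 * n]}) : Prop :=
  [/\ exists d, bracket_form d F,
      irreducible_mpoly F
    & forall A : 'M[k]_(2, n), \rank A = 2%N ->
        eval_mx F A = 0 <-> exists2 x, X x & A *m x = 0].

(* (g F)(A) = F(A g).  This is the action under which diag(t_1, ..., t_n)
   multiplies [ij] by t_i t_j; it sends the Chow form of X to that of g X. *)
Definition gl_act (g : 'M[k]_n) (F : {mpoly k[2 * n]}) : {mpoly k[2 * n]} :=
  subst_mx (coef_mx *m map_mx (@mpolyC (2 * n) k) g) F.

End ChowForm.

Section MonomialCurve.
Variables (k : closedFieldType) (gamma : nat -> nat) (N : nat).

Definition monomial_point (t : k) : 'cV[k]_N.+1 := \col_i t ^+ gamma i.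

(* Points of the Zariski closure in P^N of the image of monomial_point, in
   homogeneous coordinates. *)
Definition monomial_curve : set 'cV[k]_N.+1 :=
  [set x : 'cV[k]_N.+1 | x != 0 /\
    forall (d : nat) (P : {mpoly k[N.+1]}), P \is d.-homog ->
      (forall t, P.@[fun i => monomial_point t i 0] = 0) ->
      P.@[fun i => x i 0] = 0].

End MonomialCurve.

Arguments monomial_curve : clear implicits.

Section OnePS.
Variables (R : realType) (k : closedFieldType) (n : nat).

(* Homomorphisms of algebraic groups G_m -> GL_n, as functions on k^*; the
   value at 0 is irrelevant.  The last clause says that the entries are Laurent
   polynomials in t. *)
Definition one_ps (lam : k -> 'M[k]_n) : Prop :=
  [/\ forall t, t != 0 -> lam t \in unitmx,
      forall s t, s != 0 -> t != 0 -> lam (s * t) = lam s *m lam t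
    & exists (r : nat) (P : 'M[{poly k}]_n), forall t, t != 0 ->
        t ^+ r *: lam t = map_mx (fun p => p.[t]) P].

Definition diag_ps (w : 'rV[int]_n) (t : k) : 'M[k]_n :=
  diag_mx (\row_i t ^ w 0 i).

Definition conj_diag (lam : k -> 'M[k]_n) (w : 'rV[int]_n) : Prop :=
  exists2 g : 'M[k]_n, g \in unitmx &
    forall t, t != 0 -> lam t = g *m diag_ps w t *m invmx g.

(* mu(F, lam) = m, where s lists the weights whose component c of F is nonzero;
   such a decomposition is unique since k is infinite. *)
Definition hilbert_mumford (F : {mpoly k[2 * n]}) (lam : k -> 'M[k]_n)
    (m : int) : Prop :=
  exists (s : seq int) (c : int -> {mpoly k[2 * n]}),
    [/\ uniq s,
        F = \sum_(i <- s) c i,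
        forall i, i \in s ->
          c i != 0 /\ forall t, t != 0 -> gl_act (lam t) (c i) = t ^ i *: c i,
        m \in s
      & forall i, i \in s -> m <= i].

Definition vnorm (w : 'rV[R]_n) : R := Num.sqrt (\sum_i w 0 i ^+ 2).

(* The value r = mu(F, lam) / ||lam||, for lam nontrivial and conjugate to
   diag_ps w. *)
Definition hm_ratio (F : {mpoly k[2 * n]}) (lam : k -> 'M[k]_n)
    (w : 'rV[int]_n) (r : R) : Prop :=
  [/\ one_ps lam, conj_diag lam w, w != 0
    & exists2 m, hilbert_mumford F lam m &
        r = m%:~R / vnorm (map_mx intr w)].

Definition hm_ratios (F : {mpoly k[2 * n]}) : set R :=
  [set r | exists lam w, hm_ratio F lam w r].

(* The supremum is over all one-parameter subgroups of GL_n. *)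
Definition worst_one_ps (F : {mpoly k[2 * n]}) (lam : k -> 'M[k]_n)
    (w : 'rV[int]_n) : Prop :=
  exists2 r, hm_ratio F lam w r & supremums (hm_ratios F) r.

(* w is the weight vector, up to a positive real factor, of a worst
   one-parameter subgroup lying in the diagonal torus. *)
Definition worst_weight (F : {mpoly k[2 * n]}) (w : 'rV[R]_n) : Prop :=
  exists (v : 'rV[int]_n) (s : R),
    [/\ worst_one_ps F (diag_ps v) v, 0 < s & w = s *: map_mx intr v].

End OnePS.

(* Main.v *)
(* The Chow form of the curve is, up to a scalar, the resultant of two polynomials
   f = sum a_i x^(gamma_i) and g = sum b_i x^(gamma_i).  The extreme weights of this
   resultant correspond to chains 0 = p_0 < ... < p_r = N, so that mu(F, v) is twice
   the area under the lower convex hull of the points (gamma_i, v_i).  For v convex in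
   gamma this is the linear form sum a_(i+1) v_i, hence the worst weight vector is the
   orthogonal projection of a on the cone of convex sequences.

   As a_(i+1) = 2 for ci < i < N, the projection of a - 2, extended by 0 to
   all i, vanishes from some index l on and does not involve N.  At finite N only the
   last entry a_(N+1) = 1 differs: on [l, N] the solution is the least squares line of
   2, ..., 2, 1, and it fits the limit solution convexly at l as soon as N is large. *)

From HB Require Import structures.
Require Import Defs.
From mathcomp Require Import all_boot all_order all_fingroup all_algebra.
From mathcomp Require Import classical_sets reals.
From mathcomp Require Import ring lra zify.
From mathcomp Require Import mpoly.

Set Implicit Arguments.
Unset Strict Implicit.
Unset Printing Implicit Defensive.

Import Order.TTheory GRing.Theory Num.Theory.

Local Open Scope ring_scope.

(** * Projection on a finitely generated cone *)

(** Only two facts about weights enter at the end: mu(F, v) <= <w, v> for every diagonal v, and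
    mu(F, w) >= <w, w>. They ask opposite things of the resultant. The second needs only to know
    which terms can occur in the expansion of the determinant. The first needs certain terms to
    survive, although several terms may give the same monomial and the characteristic is arbitrary;
    hence chain monomials are isolated by a parity rule and an auxiliary weight, and have
    coefficient plus or minus 1.

    On the convex side the obstacle is that l must be found before N. The limit problem has
    infinitely many coordinates, so it is replaced by one truncation, together with an explicit
    estimate showing that the solution already vanishes before the truncation point. This part is
    carried out over the rationals, so that a multiple of w is an actual one-parameter subgroup,
    against which the supremum can be tested. *)

Section InnerProduct.
Variables (F : realFieldType) (M : nat).
Implicit Types a b c : nat -> F.

Definition dotp a b : F := \sum_(i < M) a i * b i.

Lemma dotpC a b : dotp a b = dotp b a.
Proof. by apply: eq_bigr => i _; rewrite mulrC. Qed.

Lemma dotp_linear k a b c : dotp (fun i => a i + k * b i) c = dotp a c + k * dotp b c.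
Proof.
rewrite /dotp mulr_sumr -big_split /=; apply: eq_bigr => i _.
by rewrite mulrDl mulrA.
Qed.

Lemma dotp_sumr m a (s : nat -> F) (g : nat -> nat -> F) :
  dotp a (fun i => \sum_(j < m) s j * g j i) = \sum_(j < m) s j * dotp a (g j).
Proof.
rewrite /dotp.
under eq_bigr => i _ do rewrite mulr_sumr.
rewrite exchange_big /=; apply: eq_bigr => j _; rewrite mulr_sumr.
by apply: eq_bigr => i _; ring.
Qed.

Lemma dotp_ge0 a : 0 <= dotp a a.
Proof. by apply: sumr_ge0 => i _; rewrite -expr2 sqr_ge0. Qed.

Lemma dotp_eq a a' b b' :
  (forall i, (i < M)%N -> a i = a' i) -> (forall i, (i < M)%N -> b i = b' i) ->
  dotp a b = dotp a' b'.
Proof. by move=> ha hb; apply: eq_bigr => i _; rewrite ha ?hb. Qed.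

Lemma dotp_eq0 a : dotp a a = 0 -> forall i, (i < M)%N -> a i = 0.
Proof.
move=> /eqP; rewrite psumr_eq0 => [/allP h i hi|i _]; last first.
  by rewrite -expr2 sqr_ge0.
have := h (Ordinal hi) (mem_index_enum _) => /=.
by rewrite mulf_eq0 orbb => /eqP.
Qed.

(* Induction on the number of generators: if the projection on the cone of the
   first m generators violates the condition for the last one, g m is active,
   and one projects orthogonally to g m instead. *)
Lemma cone_projection m (g : nat -> nat -> F) (u : nat -> F) :
  exists s : nat -> F, let r i := \sum_(j < m) s j * g j i - u i in
    forall j, (j < m)%N -> [/\ 0 <= s j, 0 <= dotp r (g j) & s j * dotp r (g j) = 0].
Proof.
elim: m g u => [|m IH] g u; first by exists (fun=> 0).
have [s0 hs0] := IH g u.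
set r0 := fun i => _ in hs0.
case: (leP 0 (dotp r0 (g m))) => hm.
  exists (fun j => if j == m then 0 else s0 j) => r j.
  have er i : r i = r0 i.
    rewrite /r /r0 big_ord_recr /= eqxx mul0r addr0; congr (_ - _).
    by apply: eq_bigr => l _; rewrite ltn_eqF.
  have ed b : dotp r b = dotp r0 b by apply: dotp_eq.
  rewrite ltnS leq_eqVlt ed => /orP[/eqP->|hj]; first by rewrite eqxx mul0r.
  by rewrite ltn_eqF //; apply: hs0.
set G := dotp (g m) (g m).
have G_neq0 : G != 0.
  apply/eqP => hG; suff : dotp r0 (g m) = 0 by move=> e; rewrite e ltxx in hm.
  by rewrite /dotp big1 // => i _; rewrite (dotp_eq0 hG) // mulr0.
have G_gt0 : 0 < G by rewrite lt0r G_neq0 dotp_ge0.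
(* [pr] projects orthogonally to [g m]. For the projected data, the induction hypothesis leaves the
   multiplier of [g m] free in sign; it is recovered below as [t]. *)
pose pr b i := b i - (dotp b (g m) / G) * g m i.
have prE b c : dotp (pr b) (pr c) = dotp (pr b) c.
  have orth : dotp (pr b) (g m) = 0.
    rewrite (@dotp_eq _ (fun i => b i + (- (dotp b (g m) / G)) * g m i) _ (g m)).
    - by rewrite dotp_linear -/G; field.
    - by move=> i _; rewrite /pr; ring.
    - by [].
  rewrite dotpC (@dotp_eq _ (fun i => c i + (- (dotp c (g m) / G)) * g m i) _ (pr b)).
  - by rewrite dotp_linear [dotp (g m) _]dotpC orth mulr0 addr0 dotpC.
  - by move=> i _; rewrite /pr; ring.
  - by [].
have [s hs] := IH (fun j => pr (g j)) (pr u).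
set r1 := fun i => _ in hs.
pose z i := \sum_(j < m) s j * g j i - u i.
pose t := - (dotp z (g m) / G).
have r1E i : r1 i = pr z i.
  rewrite /r1 /pr /z.
  have -> : dotp (fun i => \sum_(j < m) s j * g j i - u i) (g m)
     = \sum_(j < m) s j * dotp (g j) (g m) - dotp u (g m).
    rewrite (@dotp_eq _ (fun i => \sum_(j < m) s j * g j i + (-1) * u i) _ (g m)) //.
      rewrite dotp_linear [dotp _ (g m)]dotpC dotp_sumr mulN1r; congr (_ - _).
      by apply: eq_bigr => j _; rewrite dotpC.
    by move=> l _; ring.
  under eq_bigr => j _ do rewrite mulrBr.
  rewrite sumrB.
  have -> : \sum_(j < m) s j * (dotp (g j) (g m) / G * g m i)
     = (\sum_(j < m) s j * dotp (g j) (g m)) / G * g m i.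
    by rewrite !mulr_suml; apply: eq_bigr => j _; ring.
  by ring.
exists (fun j => if j == m then t else s j) => r.
have rE i : r i = r1 i.
  rewrite r1E /r /pr big_ord_recr /= eqxx /z.
  rewrite (eq_bigr (fun j : 'I_m => s j * g j i)); last first.
    by move=> l _; rewrite ltn_eqF.
  by rewrite /t; ring.
have rdef i : r i = z i + t * g m i.
  rewrite /r big_ord_recr /= eqxx /z (eq_bigr (fun j : 'I_m => s j * g j i)).
    by ring.
  by move=> l _; rewrite ltn_eqF.
clearbody r.
have rgj j : dotp r (g j) = dotp r1 (pr (g j)).
  rewrite (@dotp_eq r (pr z) (g j) (g j)) //; last by move=> i _; rewrite rE r1E.
  by rewrite -prE; apply: dotp_eq => // i _; rewrite r1E.
have rgm : dotp r (g m) = 0.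
  rewrite rgj /dotp big1 // => i _.
  by rewrite /pr -/G divff // mul1r subrr mulr0.
have t_ge0 : 0 <= t.
  (* for t < 0 the variational inequalities of the two projections contradict each other *)
  rewrite leNgt; apply/negP => tlt.
  have h1 : 0 <= dotp r0 z - dotp r0 r0.
    have -> : dotp r0 z - dotp r0 r0
       = \sum_(j < m) s j * dotp r0 (g j) - \sum_(j < m) s0 j * dotp r0 (g j).
      rewrite -!dotp_sumr /dotp -!sumrB; apply: eq_bigr => i _.
      rewrite -!mulrBr; congr (_ * _).
      by rewrite -[r0 i]/(\sum_(j < m) s0 j * g j i - u i) /z; ring.
    rewrite [X in _ - X]big1 ?subr0; last by move=> j _; case: (hs0 j).
    by apply: sumr_ge0 => j _; case: (hs j) => // ? _ _; case: (hs0 j) => // _ ? _; exact: mulr_ge0.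
  have h2 : 0 <= dotp r r0 - dotp r r.
    have -> : dotp r r0 - dotp r r
       = \sum_(j < m) s0 j * dotp r (g j) - \sum_(j < m) s j * dotp r (g j) - t * dotp r (g m).
      rewrite -!dotp_sumr mulrC /dotp mulr_suml -!sumrB; apply: eq_bigr => i _.
      have -> : r i * r i = r i * (z i + t * g m i) by rewrite -rdef.
      by rewrite -[r0 i]/(\sum_(j < m) s0 j * g j i - u i) /z; ring.
    rewrite rgm mulr0 subr0 [X in _ - X]big1 ?subr0; last first.
      by move=> j _; rewrite rgj; case: (hs j).
    apply: sumr_ge0 => j _; rewrite rgj; case: (hs j) => // _ ? _.
    by case: (hs0 j) => // ? _ _; exact: mulr_ge0.
  have h3 : dotp r0 z = dotp r0 r - t * dotp r0 (g m).
    rewrite mulrC /dotp mulr_suml -!sumrB; apply: eq_bigr => i _.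
    by rewrite rdef; ring.
  have h4 : dotp r0 r0 - dotp r0 r - dotp r r0 + dotp r r
      = dotp (fun i => r0 i - r i) (fun i => r0 i - r i).
    rewrite /dotp -!sumrB -big_split /=; apply: eq_bigr => i _; ring.
  have := dotp_ge0 (fun i => r0 i - r i); rewrite -h4.
  have : 0 < t * dotp r0 (g m) by rewrite nmulr_rgt0.
  by move: h1 h2; rewrite h3; lra.
move=> j; rewrite ltnS leq_eqVlt => /orP[/eqP->|hj].
  by rewrite eqxx rgm mulr0.
by rewrite ltn_eqF // rgj; apply: hs.
Qed.

End InnerProduct.

(** * The limit of the convex regression problem *)

Section Hinges.
Variables (F : realFieldType) (gamma : nat -> nat).
Hypothesis gamma_lt : forall i, (gamma i < gamma i.+1)%N.

Lemma gamma_le i j : (i <= j)%N -> (gamma i <= gamma j)%N.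
Proof.
by move=> ij; apply: (@homo_leq _ gamma leq) ij => // [? ? ?|i']; [exact: leq_trans|exact: ltnW].
Qed.

(** Truncated subtraction makes this the positive part of gamma_j - gamma_i. Together with the
    affine functions of gamma_i, the hinges generate the convex sequences. *)
Definition hinge (j i : nat) : F := (gamma j - gamma i)%N%:R.

Lemma hinge_ge0 j i : 0 <= hinge j i. Proof. exact: ler0n. Qed.

Lemma hingeE j i : (i <= j)%N -> hinge j i = (gamma j)%:R - (gamma i)%:R.
Proof. by move=> ij; rewrite /hinge natrB // gamma_le. Qed.

Lemma hinge0 j i : (j <= i)%N -> hinge j i = 0.
Proof. by move=> ji; rewrite /hinge (eqP (_ : gamma j - gamma i == 0)%N) // subn_eq0 gamma_le. Qed.

Lemma hinge_anti j i i' : (i <= i')%N -> hinge j i' <= hinge j i.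
Proof. by move=> ii; rewrite /hinge ler_nat leq_sub2l // gamma_le. Qed.

(** First and second sums of [r]. The second is the pairing with a hinge, so the optimality
    conditions of [cone_projection] become sign conditions on [tsum]. *)
Definition csum (r : nat -> F) k := \sum_(i < k) r i.
Definition tsum (r : nat -> F) j := \sum_(i < j) r i * hinge j i.

Lemma csumS r k : csum r k.+1 = csum r k + r k.
Proof. exact: big_ord_recr. Qed.

Lemma tsumS r j :
  tsum r j.+1 = tsum r j + ((gamma j.+1)%:R - (gamma j)%:R) * csum r j.+1.
Proof.
have -> : tsum r j = \sum_(i < j.+1) r i * hinge j i.
  by rewrite big_ord_recr /= hinge0 // mulr0 addr0.
rewrite /tsum /csum mulr_sumr -big_split /=; apply: eq_bigr => i _.
have ij : (i <= j)%N by rewrite -ltnS.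
by rewrite !hingeE ?(leqW ij) //; ring.
Qed.

Lemma dotp_hinge M r j : (j <= M)%N -> dotp M r (hinge j) = tsum r j.
Proof.
move=> jM; rewrite /dotp /tsum [RHS](big_ord_widen M (fun i => r i * hinge j i)) //.
rewrite [RHS]big_mkcond /=; apply: eq_bigr => i _ /=.
by case: ltnP => // ij; rewrite hinge0 // mulr0.
Qed.

End Hinges.

Section LimitProjection.
Variables (F : realFieldType) (gamma : nat -> nat) (ci : nat).
Hypothesis gamma_lt : forall i, (gamma i < gamma i.+1)%N.
Hypothesis gamma0 : gamma 0 = 0%N.
Hypothesis gamma1 : (1 < gamma 1)%N.
Hypothesis gamma_tail : forall i, (ci <= i)%N -> gamma i.+1 = (gamma i).+1.
Hypothesis ci_gt0 : (0 < ci)%N.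
Hypothesis gamma_gap : ((gamma ci.-1).+2 <= gamma ci)%N.

Local Notation hinge := (@hinge F gamma).
Local Notation tsum := (@tsum F gamma).

(** This is a_(i+1) - 2. At i = 0 the predecessor is again 0, and gamma_1 >= 2 keeps the subtraction
    from truncating. *)
Definition excess i : nat := gamma i.+1 - gamma i.-1 - 2.

Lemma excess_tail i : (ci < i)%N -> excess i = 0%N.
Proof.
case: i => // i; rewrite ltnS => h; rewrite /excess /=.
by rewrite gamma_tail ?leqW // gamma_tail //; clear; lia.
Qed.

(** The gap below the conductor makes ci the last index of nonzero excess. This term yields the
    [- 1] in [c_ub1] and the strict inequality ci < l. *)
Lemma excess_ci : (0 < excess ci)%N.
Proof. by rewrite /excess gamma_tail //; move: gamma_gap; clear; lia. Qed.

Lemma gamma_tailD i : gamma (ci + i) = (gamma ci + i)%N.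
Proof. by elim: i => [|i IH]; rewrite ?addn0 // !addnS gamma_tail ?leq_addr // IH. Qed.

Section Truncated.
Variables (M : nat) (s : nat -> F).
Let x i := \sum_(j < M.+1) s j * hinge j i.
Let r i := x i - (excess i)%:R.
Hypothesis s_ge0 : forall j, (j <= M)%N -> 0 <= s j.
Hypothesis t_ge0 : forall j, (j <= M)%N -> 0 <= tsum r j.
Hypothesis st0 : forall j, (j <= M)%N -> s j * tsum r j = 0.

Let x_ge0 i : 0 <= x i.
Proof. by apply: sumr_ge0 => j _; rewrite mulr_ge0 ?hinge_ge0 // s_ge0 // -ltnS. Qed.

Let x_anti i i' : (i <= i')%N -> x i' <= x i.
Proof.
move=> ii; apply: ler_sum => j _; apply: ler_wpM2l; first by rewrite s_ge0 // -ltnS.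
exact: hinge_anti.
Qed.

Let x_ge_term j i : (j <= M)%N -> s j * hinge j i <= x i.
Proof.
move=> jM; rewrite /x (bigD1 (Ordinal (jM : (j < M.+1)%N))) //= lerDl.
by apply: sumr_ge0 => l _; rewrite mulr_ge0 ?hinge_ge0 // s_ge0 // -ltnS.
Qed.

Let U := (\sum_(i < M) excess i)%N.

(** Complementary slackness gives <x, x> = <excess, x>; as x decreases, x_0^2 <= <x, x> <= x_0 U. *)
Let x0_le : x 0 <= U%:R.
Proof.
have [->|x0] := eqVneq (x 0) 0; first exact: ler0n.
have xpos : 0 < x 0 by rewrite lt0r x0 x_ge0.
rewrite -(ler_pM2l xpos).
have e : dotp M r x = 0.
  rewrite dotp_sumr big1 // => j _.
  by rewrite dotp_hinge // ?st0 // -ltnS.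
have M_gt0 : (0 < M)%N.
  rewrite lt0n; apply/eqP => M0; move: x0; rewrite /x big1 ?eqxx // => j _.
  by rewrite hinge0 ?mulr0 // -ltnS -[1%N]/(0.+1) -M0.
have e2 : dotp M x x = dotp M (fun i => (excess i)%:R) x.
  apply/eqP; rewrite -subr_eq0 /dotp -sumrB; apply/eqP.
  by rewrite -{}[RHS]e; apply: eq_bigr => i _; rewrite /r; ring.
apply: (@le_trans _ _ (dotp M x x)).
  rewrite /dotp (bigD1 (Ordinal M_gt0)) //= lerDl.
  by apply: sumr_ge0 => i _; rewrite mulr_ge0.
rewrite e2 /dotp natr_sum mulr_sumr; apply: ler_sum => i _.
by rewrite mulrC ler_wpM2r ?ler0n // x_anti.
Qed.

(* If the last hinge is active, the residual sums force the second sum at ci to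
   grow linearly with the length of the tail, whereas it is bounded. *)
Lemma truncated_projection_vanishes q :
  M = (ci + (3 * q).+1)%N -> (ci < q)%N -> (gamma ci < q)%N ->
  (17 * (gamma ci * ci * U) < q)%N -> x M.-1 = 0.
Proof.
move=> defM qci qg qU; apply/eqP; apply: contraT => xM0.
have Mgt1 : (1 < M)%N by lia.
have xM_gt0 : 0 < x M.-1 by rewrite lt0r xM0 x_ge0.
have gM k : (ci <= k)%N -> (gamma k.+1)%:R - (gamma k)%:R = 1 :> F.
  by move=> h; rewrite gamma_tail // -addn1 natrD; ring.
have xME : x M.-1 = s M.
  rewrite /x big_ord_recr /= big1 ?add0r => [|j _]; last first.
    by rewrite hinge0 ?mulr0 //; have := ltn_ord j; lia.
  rewrite hingeE //; last exact: leq_pred.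
  by have := gM M.-1; rewrite prednK; [move=> ->; [rewrite mulr1|lia]|lia].
have tM : tsum r M = 0.
  by have /eqP := st0 (leqnn M); rewrite mulf_eq0 -xME (negbTE xM0) => /eqP.
have step k : (ci <= k)%N -> tsum r k.+1 = tsum r k + csum r k.+1.
  by move=> h; rewrite tsumS // gM // mul1r.
have rE k : (ci < k)%N -> r k = x k by move=> h; rewrite /r excess_tail // subr0.
(* The second sum reaches 0 at M from a nonnegative value across a gap of 1, and [csum r M] is that
   last increment. *)
have cM : csum r M <= 0.
  have := t_ge0 (leq_pred M); have := step M.-1 ltac:(lia).
  by rewrite prednK ?tM; [lra|lia].
have cE n k : (ci < k)%N -> csum r (k + n) = csum r k + \sum_(i < n) x (k + i)%N.
  move=> h; elim: n => [|n IH]; first by rewrite addn0 big_ord0 addr0.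
  by rewrite addnS csumS IH big_ord_recr rE ?addrA //; lia.
have c_le k : (ci < k <= M)%N -> csum r k <= - \sum_(i < M - k) x (k + i)%N.
  move=> /andP[h1 h2]; have := cE (M - k)%N k h1; rewrite subnKC //.
  by move: cM; lra.
have c_le0 k : (ci < k <= M)%N -> csum r k <= 0.
  by move=> h; apply: le_trans (c_le k h) _; rewrite oppr_le0 sumr_ge0.
have c_lt0 k : (ci < k < M)%N -> csum r k < 0.
  move=> h; apply: le_lt_trans (c_le k _) _; first lia.
  rewrite oppr_lt0; have kM : (0 < M - k)%N by lia.
  rewrite (bigD1 (Ordinal kM)) //=; apply: ltr_pwDl.
    by apply: lt_le_trans xM_gt0 (x_anti _); lia.
  exact: sumr_ge0.
have tE n k : (ci <= k)%N -> tsum r (k + n) = tsum r k + \sum_(i < n) csum r (k + i).+1.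
  move=> h; elim: n => [|n IH]; first by rewrite addn0 big_ord0 addr0.
  by rewrite addnS step ?IH ?big_ord_recr ?addrA //; lia.
have t_gt0 k : (ci <= k < M.-1)%N -> 0 < tsum r k.
  move=> h; have := tE (M - k)%N k ltac:(lia); rewrite subnKC; last lia.
  rewrite tM => e.
  have -> : tsum r k = - \sum_(i < M - k) csum r (k + i).+1 by move: e; lra.
  rewrite -sumrN; have kM : (0 < M - k)%N by lia.
  rewrite (bigD1 (Ordinal kM)) //=; apply: ltr_pwDl.
    by rewrite oppr_gt0 c_lt0 //; lia.
  by apply: sumr_ge0 => i _; rewrite oppr_ge0 c_le0 //; have := ltn_ord i; lia.
(* Where the second sum is positive no hinge is active, so on the tail x comes from the hinges at M
   - 1 and M alone. *)
have s0 k : (ci <= k < M.-1)%N -> s k = 0.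
  move=> h; have kM : (k <= M)%N by lia.
  have /eqP := st0 kM; rewrite mulf_eq0 => /orP[/eqP//|/eqP e].
  by have := t_gt0 k h; rewrite e ltxx.
(* p is the last active hinge before ci, or 0 *)
have [p [p_ci tp sp]] : exists p, [/\ (p < ci)%N, tsum r p = 0
    & forall j, (p < j < ci)%N -> s j = 0].
  pose P p := (p < ci)%N && (tsum r p == 0).
  have exP : exists p, P p by exists 0%N; rewrite /P ci_gt0 /tsum big_ord0 eqxx.
  have ubP p : P p -> (p <= ci)%N by case/andP => /ltnW.
  have [p /andP[p1 /eqP p2] p3] := ex_maxnP exP ubP.
  exists p; split => // j /andP[j1 j2]; apply/eqP.
  have jM : (j <= M)%N by lia.
  have /eqP := st0 jM; rewrite mulf_eq0 => /orP[//|e].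
  by have := p3 j; rewrite /P j2 e => /(_ isT); rewrite leqNgt j1.
have cp : csum r p <= 0.
  case: p p_ci tp {sp} => [|p] h; first by rewrite /csum big_ord0.
  rewrite tsumS // => e; have h1 : 0 <= tsum r p by apply: t_ge0; lia.
  have h2 : 0 < (gamma p.+1)%:R - (gamma p)%:R :> F by rewrite subr_gt0 ltr_nat.
  rewrite -(pmulr_rle0 _ h2); move: e h1; lra.
(* From p on, x combines the hinges at M - 1 and M with total coefficient [sg]; the upper and lower
   bounds below are both proportional to it. *)
set sg := s M + s M.-1.
have sg_ge0 : 0 <= sg by rewrite addr_ge0 ?s_ge0 // leq_pred.
have xpE i : (p <= i)%N -> x i = s M.-1 * hinge M.-1 i + s M * hinge M i.
  move=> pi; rewrite /x big_ord_recr /=; congr (_ + _).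
  rewrite -(prednK (ltnW Mgt1)) big_ord_recr /= big1 ?add0r // => j _.
  have := ltn_ord j => jM.
  have [ji|ij] := leqP j i; first by rewrite hinge0 ?mulr0.
  have [jc|cj] := ltnP j ci; first by rewrite sp ?mul0r // (leq_ltn_trans pi).
  by rewrite s0 ?mul0r //; lia.
have x_ub i : (p <= i)%N -> x i <= sg * (gamma M)%:R.
  move=> pi; rewrite xpE // /sg mulrDl addrC.
  apply: lerD; apply: ler_wpM2l; rewrite ?s_ge0 ?leq_pred // /hinge ler_nat.
    by rewrite leq_subr.
  by rewrite (leq_trans (leq_subr _ _)) // gamma_le ?leq_pred.
have x_lb i : (p <= i)%N -> sg * hinge M.-1 i <= x i.
  move=> pi; rewrite xpE // /sg mulrDl addrC lerD2l.
  apply: ler_wpM2l; rewrite ?s_ge0 // /hinge ler_nat leq_sub2r // gamma_le //.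
  exact: leq_pred.
have csumD n : csum r (p + n) <= n%:R * (sg * (gamma M)%:R) - \sum_(i < n) (excess (p + i))%:R.
  elim: n => [|n IH]; first by rewrite addn0 big_ord0 mul0r subr0.
  rewrite addnS csumS big_ord_recr /= -addn1 natrD mulrDl mul1r {2}/r.
  by have := x_ub (p + n)%N (leq_addr _ _); move: IH; lra.
have c_ub1 k : (ci < k <= M)%N -> csum r k <= M%:R * (sg * (gamma M)%:R) - 1.
  move=> h; have := csumD (k - p)%N; rewrite subnKC; last lia.
  move=> /le_trans; apply; apply: lerB.
    by apply: ler_wpM2r; rewrite ?mulr_ge0 ?ler0n // ler_nat; lia.
  have ck : (ci - p < k - p)%N by lia.
  rewrite (bigD1 (Ordinal ck)) //= subnKC; last lia.
  have := excess_ci; rewrite -(ler_nat F) => h1.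
  by apply: le_trans h1 _; rewrite lerDl sumr_ge0.
have c_ub2 k : (ci < k <= ci + q)%N -> csum r k <= - (q%:R * (q%:R * sg)).
  move=> h; apply: le_trans (c_le k _) _; first lia.
  rewrite lerN2.
  have -> : (M - k = q + (M - k - q))%N by lia.
  rewrite big_split_ord /=; apply: (@le_trans _ _ (\sum_(i < q) q%:R * sg)).
    by rewrite sumr_const card_ord -[X in _ <= X]mulr_natl.
  apply: (@le_trans _ _ (\sum_(i < q) x (k + i)%N)); last first.
    by rewrite lerDl sumr_ge0.
  apply: ler_sum => i _; apply: le_trans (x_lb _ _); last lia.
  rewrite mulrC; apply: ler_wpM2l => //.
  rewrite /hinge ler_nat.
  have := gamma_tailD (3 * q)%N; have := gamma_tailD (k + i - ci)%N.
  rewrite subnKC; last lia.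
  have -> : (ci + 3 * q = M.-1)%N by lia.
  have := ltn_ord i; lia.
(* Both [M] and [gamma M] are at most 4 q, whence 16. Adding 16 times [c_ub2] to [c_ub1] eliminates
   [sg] and leaves 17. *)
have key k : (ci < k <= ci + q)%N -> 1 <= 17%:R * - csum r k.
  move=> h; have h1 := c_ub1 k ltac:(lia); have h2 := c_ub2 k h.
  have h3 : M%:R * (gamma M)%:R <= 16%:R * (q%:R * q%:R) :> F.
    rewrite -!natrM ler_nat defM gamma_tailD.
    apply: (@leq_trans ((4 * q) * (4 * q))%N); last by clear; lia.
    by apply: leq_mul; move: qci qg; clear; lia.
  have h4 := ler_wpM2l sg_ge0 h3.
  have : M%:R * (sg * (gamma M)%:R) = sg * (M%:R * (gamma M)%:R) :> F by ring.
  move: h1 h2 h4; set A := M%:R * (sg * _); set B := sg * (M%:R * _).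
  have -> : sg * (16%:R * (q%:R * q%:R)) = 16%:R * (q%:R * (q%:R * sg)) by ring.
  by set C := q%:R * _; lra.
have tci_lb : q%:R <= 17%:R * tsum r ci.
  have := tE q ci (leqnn _) => e.
  have h1 : 0 <= tsum r (ci + q) by apply: t_ge0; lia.
  have -> : q%:R = \sum_(i < q) (1 : F) by rewrite sumr_const card_ord.
  apply: (@le_trans _ _ (\sum_(i < q) 17%:R * - csum r (ci + i).+1)).
    by apply: ler_sum => i _; apply: key; have := ltn_ord i; lia.
  by rewrite -mulr_sumr sumrN; move: h1; rewrite e; lra.
have tci_ub : tsum r ci <= (gamma ci * ci * U)%:R.
  apply: (@le_trans _ _ (\sum_(i < ci) (U * gamma ci)%:R)); last first.
    by rewrite sumr_const card_ord -mulrnA ler_nat; lia.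
  apply: ler_sum => i _; rewrite natrM.
  apply: (@le_trans _ _ (U%:R * hinge ci i)); last first.
    by apply: ler_wpM2l; rewrite ?ler0n // /hinge ler_nat leq_subr.
  apply: ler_wpM2r; first exact: hinge_ge0.
  rewrite /r; apply: (@le_trans _ _ (x i)); first by rewrite gerBl ler0n.
  by apply: le_trans x0_le; exact: x_anti.
have := le_trans tci_lb (ler_wpM2l (ler0n F 17) tci_ub).
by rewrite -natrM ler_nat; move: qU; clear; lia.
Qed.

End Truncated.

(** l is the first zero of the projection x for one long truncation. From l on the residual is minus
    the excess, so first and second sums can only decrease; since second sums stay nonnegative, ci <
    l and the first sum vanishes at l. Strict positivity of [s l] leaves room for the perturbation
    at finite N. *)
Lemma limit_projection : exists (l : nat) (s : nat -> F),
  let x i := \sum_(j < l.+1) s j * hinge j i in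
  let r i := x i - (excess i)%:R in
  [/\ (ci < l)%N, 0 < s l, csum r l = 0, tsum r l = 0
    & forall j, (j <= l)%N -> [/\ 0 <= s j, 0 <= tsum r j & s j * tsum r j = 0]].
Proof.
(* The estimate bounds q below by a sum of [excess] over i < M, while M depends on q. As [excess]
   vanishes after ci, the sum over i <= ci has the same value and breaks the circle. *)
pose B := (17 * (gamma ci * ci * \sum_(i < ci.+1) excess i))%N.
pose q := (ci + gamma ci + B).+1.
pose M := (ci + (3 * q).+1)%N.
have [s hs] := cone_projection M M.+1 hinge (fun i => (excess i)%:R : F).
pose x i := \sum_(j < M.+1) s j * hinge j i.
pose r i := x i - (excess i)%:R.
have s_ge0 j : (j <= M)%N -> 0 <= s j by move=> h; case: (hs j).
have t_ge0 j : (j <= M)%N -> 0 <= tsum r j.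
  by move=> h; case: (hs j) => // _; rewrite dotp_hinge.
have st0 j : (j <= M)%N -> s j * tsum r j = 0.
  by move=> h; case: (hs j) => // _ _; rewrite dotp_hinge.
have xM : x M.-1 = 0.
  apply: (truncated_projection_vanishes s_ge0 t_ge0 st0 (q := q)) => //; rewrite /q; try lia.
  rewrite ltnS (leq_trans _ (leq_addl _ _)) // /B leq_mul2l leq_mul2l; apply/orP; right; apply/orP; right.
  have -> : M = (ci.+1 + (3 * q))%N by rewrite /M; lia.
  rewrite big_split_ord /= [X in (_ + X)%N]big1 ?addn0 // => i _.
  by apply: excess_tail; lia.
have x_ge_term j i : (j <= M)%N -> s j * hinge j i <= x i.
  move=> jM; rewrite /x (bigD1 (Ordinal (jM : (j < M.+1)%N))) //= lerDl.
  by apply: sumr_ge0 => l _; rewrite mulr_ge0 ?hinge_ge0 // s_ge0 // -ltnS.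
have x_anti i i' : (i <= i')%N -> x i' <= x i.
  move=> ii; apply: ler_sum => j _; apply: ler_wpM2l; first by rewrite s_ge0 // -ltnS.
  exact: hinge_anti.
have x_ge0 i : 0 <= x i.
  by apply: sumr_ge0 => j _; rewrite mulr_ge0 ?hinge_ge0 // s_ge0 // -ltnS.
have exl : exists l, x l == 0 by exists M.-1; apply/eqP.
have [l /eqP xl lmin] := ex_minnP exl.
have lM : (l <= M.-1)%N by apply: lmin; apply/eqP.
have x0 i : (l <= i)%N -> x i = 0.
  by move=> h; apply/eqP; rewrite eq_le x_ge0 -xl x_anti.
have s0 j : (l < j <= M)%N -> s j = 0.
  case/andP; case: j => // j lj jM; apply/eqP.
  have := x_ge_term _ j jM; rewrite x0 // => h.
  have hp : 0 < hinge j.+1 j by rewrite /hinge ltr0n subn_gt0.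
  by rewrite eq_le s_ge0 // andbT -(pmulr_lle0 _ hp).
have r_le0 i : (l <= i)%N -> r i <= 0.
  by move=> h; rewrite /r x0 // sub0r oppr_le0 ler0n.
have pos j : 0 < (gamma j.+1)%:R - (gamma j)%:R :> F by rewrite subr_gt0 ltr_nat.
have s_neq0 : (0 < l)%N -> s l <> 0.
  move=> l_gt0 sl0.
  have : x l.-1 == 0.
    rewrite /x big1 // => j _.
    have [jl|lj] := leqP j l.-1; first by rewrite hinge0 ?mulr0.
    have [->|jl] := eqVneq (j : nat) l; first by rewrite sl0 mul0r.
    by rewrite s0 ?mul0r //; have := ltn_ord j; lia.
  by move/lmin; lia.
have tl : tsum r l = 0.
  have lM' : (l <= M)%N by lia.
  have [->|l_gt0] := posnP l; first by rewrite /tsum big_ord0.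
  have /eqP := st0 l lM'; rewrite mulf_eq0 => /orP[/eqP sl0|/eqP//].
  by case: (s_neq0 l_gt0).
have cl : csum r l <= 0.
  case: (l) tl lM => [|l']; first by rewrite /csum big_ord0.
  rewrite tsumS // => e lM; have h1 : 0 <= tsum r l' by apply: t_ge0; lia.
  rewrite -(pmulr_rle0 _ (pos l')); move: e h1; lra.
have cdecr k : (l <= k)%N -> csum r k <= csum r l.
  elim: k => [|k IH]; first by rewrite leqn0 => /eqP->.
  rewrite leq_eqVlt => /orP[/eqP->//|h].
  by rewrite csumS; have := r_le0 k h; have := IH h; lra.
have tdecr k : (l <= k)%N -> tsum r k <= 0.
  elim: k => [|k IH]; first by rewrite leqn0 => /eqP<-; rewrite tl.
  rewrite leq_eqVlt => /orP[/eqP<-|h]; first by rewrite tl.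
  rewrite tsumS //; rewrite -[leRHS]addr0; apply: lerD; first exact: IH.
  by rewrite pmulr_rle0 //; apply: le_trans cl; apply: cdecr; apply: leqW.
have cil : (ci < l)%N.
  rewrite ltnNge; apply/negP => lc.
  have h1 : 0 <= tsum r ci.+1 by apply: t_ge0; lia.
  suff : tsum r ci.+1 < 0 by rewrite ltNge h1.
  rewrite tsumS // -[ltRHS]addr0; apply: ler_ltD; first exact: tdecr.
  rewrite pmulr_rlt0 // csumS -[ltRHS]add0r.
  apply: ler_ltD; first by apply: le_trans cl; apply: cdecr.
  by rewrite /r x0 // sub0r oppr_lt0 ltr0n excess_ci.
have cl0 : csum r l = 0.
  apply/eqP; rewrite eq_le cl /=.
  have h1 : 0 <= tsum r l.+1 by apply: t_ge0; lia.
  move: h1; rewrite tsumS // tl add0r pmulr_rge0 // csumS.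
  by have := r_le0 l (leqnn l); lra.
have sl : 0 < s l.
  rewrite lt0r s_ge0 ?andbT; last lia.
  apply/eqP => sl0.
  by case: s_neq0 => //; apply: leq_ltn_trans cil.
exists l, s => x' r'.
have xE i : x' i = x i.
  rewrite /x /x'; have -> : M.+1 = (l.+1 + (M - l))%N by lia.
  rewrite big_split_ord /= [X in _ + X]big1 ?addr0 // => j _.
  by rewrite s0 ?mul0r //; have := ltn_ord j; lia.
have rE i : r' i = r i by rewrite /r' xE.
have tE j : tsum r' j = tsum r j by apply: eq_bigr => i _; rewrite rE.
have cE j : csum r' j = csum r j by apply: eq_bigr => i _; rewrite rE.
rewrite cE tE; split => // j jl; rewrite tE.
by split; [apply: s_ge0; lia|apply: t_ge0; lia|apply: st0; lia].
Qed.

End LimitProjection.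

(** * Convex functions on the semigroup *)

Section Convexity.
Variables (F : realFieldType) (gamma : nat -> nat).
Hypothesis gamma_lt : forall i, (gamma i < gamma i.+1)%N.
Hypothesis gamma0 : gamma 0 = 0%N.

Local Notation hinge := (@hinge F gamma).
Local Notation g i := ((gamma i)%:R : F).

Definition slope (h : nat -> F) k := (h k.+1 - h k) / (g k.+1 - g k).

Lemma gammaB_gt0 i j : (i < j)%N -> 0 < g j - g i.
Proof.
by move=> ij; rewrite subr_gt0 ltr_nat (leq_trans (gamma_lt i)) // gamma_le.
Qed.

Lemma slopeK h k : h k.+1 = h k + slope h k * (g k.+1 - g k).
Proof. by rewrite /slope divfK ?subrKC // lt0r_neq0 // gammaB_gt0. Qed.

(** Extend the last edge to the left and correct by the jump of slope at each interior point. The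
    term j = 0 vanishes because [0.-1] is 0. *)
Lemma hinge_decomposition (h : nat -> F) n i : (i <= n.+1)%N ->
  h i = (h n.+1 - slope h n * g n.+1) + slope h n * g i
        + \sum_(j < n.+1) (slope h j - slope h j.-1) * hinge j i.
Proof.
elim: n i => [|n IH] i.
  rewrite big_ord1 /= subrr mul0r addr0.
  case: i => [|[|//]] _; last by ring.
  by rewrite [h 1%N]slopeK; ring.
rewrite leq_eqVlt ltnS => /orP[/eqP->|hi].
  rewrite big1 ?addr0 => [|j _]; first by ring.
  by rewrite hinge0 ?mulr0 // ltnW.
rewrite big_ord_recr /= [LHS]IH // hingeE // [h n.+2]slopeK.
by ring.
Qed.

(** Weights c enter only through their total mass, first moment and hinge moments. This is how the
    chain monomial, the vector a and the residual w - a are compared. *)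
Lemma sum_hinge_decomposition (I : finType) (c : I -> F) (f : I -> nat)
    (h : nat -> F) n : (forall i, (f i <= n.+1)%N) ->
  \sum_i c i * h (f i) = (h n.+1 - slope h n * g n.+1) * (\sum_i c i)
     + slope h n * (\sum_i c i * g (f i))
     + \sum_(j < n.+1) (slope h j - slope h j.-1) * \sum_i c i * hinge j (f i).
Proof.
move=> hf; under [X in _ + X]eq_bigr => j _ do rewrite mulr_sumr.
rewrite exchange_big /= !mulr_sumr -!big_split /=; apply: eq_bigr => i _.
rewrite {1}(hinge_decomposition h (hf i)) !mulrDr mulr_sumr; congr (_ + _ + _).
- by ring.
- by ring.
by apply: eq_bigr => j _; ring.
Qed.

Lemma exists_argmin (f : nat -> F) p n : (p <= n)%N ->
  exists2 q, (p <= q <= n)%N & forall i, (p <= i <= n)%N -> f q <= f i.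
Proof.
move=> /subnKC <-; elim: (n - p)%N => [|m [q hq qmin]].
  exists p; first by rewrite addn0 leqnn.
  by move=> i; rewrite addn0 => /anti_leq<-.
have [h|h] := leP (f q) (f (p + m.+1)%N).
  exists q => [|i hi]; first lia.
  have [->//|ne] := eqVneq i (p + m.+1)%N.
  by apply: qmin; lia.
exists (p + m.+1)%N => [|i hi]; first lia.
have [->//|ne] := eqVneq i (p + m.+1)%N.
by apply: le_trans (ltW h) (qmin _ _); lia.
Qed.

(* Gift wrapping: the first edge of the hull has minimal slope. *)
Lemma convex_minorant (v : nat -> F) N p : (p <= N)%N ->
  exists h : nat -> F,
  [/\ h p = v p, h N = v N, forall i, (p <= i <= N)%N -> h i <= v i,
      forall j, (p < j < N)%N -> slope h j.-1 <= slope h j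
        /\ (slope h j.-1 < slope h j -> h j = v j)
    & forall A B, (forall i, (p <= i <= N)%N -> A + B * g i <= v i) ->
        forall i, (p <= i <= N)%N -> A + B * g i <= h i].
Proof.
move: {2}(N - p)%N (leqnn (N - p)%N) => m; elim: m p => [|m IH] p hm pN.
  have -> : p = N by lia.
  by exists v; split=> // j; lia.
have [pN'|pN'] := leqP N p.
  have -> : p = N by lia.
  by exists v; split=> // j; lia.
pose f q := (v q - v p) / (g q - g p).
have [q hq qmin] := exists_argmin f pN'.
have [h' [h1 h2 h3 h4 h5]] := IH q ltac:(lia) ltac:(lia).
pose L i := v p + f q * (g i - g p).
have Lq : L q = v q.
  have qp : g q - g p != 0 by rewrite lt0r_neq0 // gammaB_gt0; lia.
  by rewrite /L /f divfK ?subrKC.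
have Lp : L p = v p by rewrite /L subrr mulr0 addr0.
have Lv i : (p <= i <= N)%N -> L i <= v i.
  move=> hi; have [->|ip] := eqVneq i p; first by rewrite Lp.
  have ip' : 0 < g i - g p by apply: gammaB_gt0; lia.
  have := qmin i ltac:(lia).
  by rewrite {2}/f ler_pdivlMr // /L; lra.
have LAB i : L i = (v p - f q * g p) + f q * g i by rewrite /L; ring.
(* The clause on affine minorants in the induction hypothesis, applied to the first edge, gives
   convexity at the junction q. *)
have Lh' i : (q <= i <= N)%N -> L i <= h' i.
  move=> hi; rewrite LAB; apply: h5 hi => j hj; rewrite -LAB; apply: Lv; lia.
pose h i := if (i <= q)%N then L i else h' i.
have hq' i : (q <= i)%N -> h i = h' i.
  rewrite leq_eqVlt /h => /orP[/eqP<-|]; first by rewrite leqnn Lq h1.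
  by rewrite ltnNge => /negbTE->.
have hL i : (i <= q)%N -> h i = L i by rewrite /h => ->.
have slopeL k : (k < q)%N -> slope h k = f q.
  move=> kq; rewrite /slope !hL //; last exact: ltnW.
  apply: (canLR (mulfK _)); last by rewrite /L; ring.
  by rewrite lt0r_neq0 // gammaB_gt0.
have slopeh' k : (q <= k)%N -> slope h k = slope h' k.
  by move=> qk; rewrite /slope !hq' //; apply: leqW.
exists h; split.
- by rewrite hL ?Lp //; lia.
- by rewrite hq' ?h2 //; lia.
- move=> i hi; have [iq|qi] := leqP i q; first by rewrite hL // Lv.
  by rewrite hq' ?h3 //; lia.
- move=> j hj; case: (ltngtP j q) => jq.
  + by rewrite !slopeL ?ltxx //; lia.
  + by rewrite !slopeh' ?hq'; [apply: h4|..]; lia.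
  + rewrite jq (slopeh' q) // (slopeL q.-1); last lia.
    split; last by rewrite hL.
    rewrite /slope ler_pdivlMr ?gammaB_gt0 // h1.
    have := Lh' q.+1 ltac:(lia); have := Lq; rewrite /L; lra.
move=> A B hAB i hi; have [iq|qi] := leqP i q; last first.
  by rewrite hq'; [apply: h5 => [i' hi'|]; [apply: hAB|]|]; lia.
rewrite hL // /L.
have Ap : A + B * g p <= v p by apply: hAB; lia.
have Aq : A + B * g q <= v p + f q * (g q - g p) by rewrite -/(L q) Lq; apply: hAB; lia.
have [e|ip] := eqVneq i p; first by rewrite e subrr mulr0 addr0.
have [e|iq'] := eqVneq i q; first by rewrite e.
have d1 : 0 < g i - g p by apply: gammaB_gt0; lia.
have d2 : 0 < g q - g i by apply: gammaB_gt0; lia.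
(* On the first edge the claim is a convex combination of its cases at p and q. *)
rewrite -subr_ge0 -(pmulr_rge0 _ (addr_gt0 d1 d2)).
have -> : (g i - g p + (g q - g i)) * (v p + f q * (g i - g p) - (A + B * g i))
   = (g q - g i) * (v p - (A + B * g p))
     + (g i - g p) * (v p + f q * (g q - g p) - (A + B * g q)) by ring.
by apply: addr_ge0; apply: mulr_ge0; rewrite ?subr_ge0 // ltW // -subr_gt0.
Qed.

End Convexity.

(** * The convex regression problem for a fixed N *)

Section FiniteProjection.
Variables (F : realFieldType) (gamma : nat -> nat) (ci : nat).
Hypothesis gamma_lt : forall i, (gamma i < gamma i.+1)%N.
Hypothesis gamma0 : gamma 0 = 0%N.
Hypothesis gamma1 : (1 < gamma 1)%N.
Hypothesis gamma_tail : forall i, (ci <= i)%N -> gamma i.+1 = (gamma i).+1.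

Local Notation hinge := (@hinge F gamma).
Local Notation g i := ((gamma i)%:R : F).

Lemma avecE N i : (i < N)%N -> avec gamma N i.+1 = (gamma i.+1 - gamma i.-1)%N.
Proof.
move=> iN; rewrite /avec; case: i iN => [|i] iN /=; first by rewrite gamma0 subn0.
by rewrite eqSS ltn_eqF // subn2.
Qed.

Lemma avec_last N : (0 < N)%N -> avec gamma N N.+1 = 1%N.
Proof. by move=> N0; rewrite /avec eqSS eqxx; case: eqP => // -[e]; rewrite e in N0. Qed.

Local Notation a N i := ((avec gamma N i.+1)%:R : F).

Lemma csum_avec N k : (k < N)%N -> csum (fun i => a N i) k.+1 = g k.+1 + g k.
Proof.
elim: k => [|k IH] kN; rewrite csumS avecE //.
  by rewrite /csum big_ord0 /= gamma0 subn0 add0r addr0.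
rewrite IH ?natrB; [by ring|exact/(gamma_le gamma_lt)/leqW|exact: ltnW].
Qed.

(** The first sums telescope to gamma_k + gamma_(k+1), and times the gap this is a difference of
    squares. The result is the lower bound in [admissible_hinge], which ties a to the resultant. *)
Lemma tsum_avec N j : (j <= N)%N -> tsum gamma (fun i => a N i) j = g j ^+ 2.
Proof.
elim: j => [|j IH] jN; first by rewrite /tsum big_ord0 gamma0 expr0n.
by rewrite tsumS // IH ?csum_avec // ?(ltnW jN) //; ring.
Qed.

Lemma tsum_bigE N (r : nat -> F) j : (j <= N)%N ->
  \sum_(i < N.+1) r i * hinge j i = tsum gamma r j.
Proof. by move=> jN; rewrite -(dotp_hinge gamma_lt r (leqW jN)). Qed.

Lemma sum_gammaE N (r : nat -> F) :
  \sum_(i < N.+1) r i * g i = g N * csum r N.+1 - tsum gamma r N.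
Proof.
rewrite -(tsum_bigE r (leqnn N)) /csum mulr_sumr -sumrB; apply: eq_bigr => i _.
have iN : (i <= N)%N by rewrite -ltnS.
by rewrite hingeE //; ring.
Qed.

Lemma sum_avec N : (ci < N)%N -> \sum_(i < N.+1) a N i = 2 * g N.
Proof.
case: N => // N cN; rewrite -/(csum (fun i => a N.+1 i) _) csumS csum_avec // avec_last //.
by rewrite gamma_tail // -addn1 natrD; ring.
Qed.

Lemma sum_avec_gamma N : (ci < N)%N -> \sum_(i < N.+1) a N i * g i = g N ^+ 2.
Proof.
move=> cN; rewrite (sum_gammaE N (fun i => a N i)) tsum_avec // /csum sum_avec //; ring.
Qed.

Lemma sum_avec_hinge N j : (j <= N)%N -> \sum_(i < N.+1) a N i * hinge j i = g j ^+ 2.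
Proof. by move=> jN; rewrite (tsum_bigE (fun i => a N i)) // tsum_avec. Qed.

Variables (l : nat) (s : nat -> F).
Local Notation x i := (\sum_(j < l.+1) s j * hinge j i).
Local Notation r i := (x i - (excess gamma i)%:R).
Hypothesis ci_lt_l : (ci < l)%N.
Hypothesis csum_l : csum (fun i => r i) l = 0.
Hypothesis tsum_l : tsum gamma (fun i => r i) l = 0.
Hypothesis kkt : forall j, (j <= l)%N ->
  [/\ 0 <= s j, 0 <= tsum gamma (fun i => r i) j & s j * tsum gamma (fun i => r i) j = 0].

(** The line m i + b of the theorem, expanded about i = l so that its coefficients depend on T
    alone. *)
Definition tail_line N i : F :=
  let T := N%:R - l%:R in
  2 + (2 * T - 2 - 6 * (i%:R - l%:R)) / ((T + 1) * (T + 2)).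

Definition worst_coord N i : F := if (i < l)%N then 2 + x i else tail_line N i.

Local Notation w := worst_coord.

Section FixedN.
Variable N : nat.
Hypothesis lN : (l < N)%N.
Hypothesis large : 2 / (N%:R - l%:R + 1) <= s l.

Let T : F := N%:R - l%:R.
Let T_ge1 : 1 <= T.
Proof. by rewrite /T lerBrDr addrC natr1 ler_nat. Qed.

Let D_gt0 : 0 < (T + 1) * (T + 2).
Proof. by apply: mulr_gt0; move: T_ge1; lra. Qed.

Let D1 : T + 1 != 0. Proof. by apply: lt0r_neq0; move: T_ge1; lra. Qed.
Let D2 : T + 2 != 0. Proof. by apply: lt0r_neq0; move: T_ge1; lra. Qed.

Let res i : F := w N i - a N i.

Let a_small i : (i < N)%N -> a N i = 2 + (excess gamma i)%:R.
Proof.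
move=> iN; rewrite avecE // /excess -natrD; congr (_%:R); case: i iN => [|i] iN /=.
  by move: gamma1; rewrite gamma0; lia.
by have := gamma_lt i; have := gamma_lt i.+1; lia.
Qed.

Let res_small i : (i < l)%N -> res i = r i.
Proof. by move=> il; rewrite /res /worst_coord il a_small ?(ltn_trans il) //; ring. Qed.

Let res_tail i : (l <= i < N)%N -> res i = tail_line N i - 2.
Proof.
move=> /andP[li iN]; rewrite /res /worst_coord ltnNge li /= a_small //.
by rewrite (excess_tail gamma_tail) ?addr0 // (leq_trans ci_lt_l).
Qed.

Let gamma_l i : (l <= i)%N -> g i = g l + (i%:R - l%:R).
Proof.
move=> li; rewrite -natrB // -natrD; congr (_%:R).
have := gamma_tailD gamma_tail (i - ci); have := gamma_tailD gamma_tail (l - ci).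
by rewrite !subnKC; lia.
Qed.

Let csum_res_l : csum res l = 0.
Proof. by rewrite -[RHS]csum_l; apply: eq_bigr => i _; rewrite res_small. Qed.

Let tsum_res j : (j <= l)%N -> tsum gamma res j = tsum gamma (fun i => r i) j.
Proof. by move=> jl; apply: eq_bigr => i _; rewrite res_small // (leq_trans (ltn_ord i)). Qed.

Let csum_res k : (l + k <= N)%N ->
  csum res (l + k) = k%:R * (2 * T + 1 - 3 * k%:R) / ((T + 1) * (T + 2)).
Proof.
elim: k => [|k IH] h; first by rewrite addn0 csum_res_l !mul0r.
rewrite addnS csumS IH ?res_tail /tail_line -/T; [|lia..].
rewrite natrD -natr1; field; rewrite -/T; exact/andP.
Qed.

(** The closed form is nonnegative for 0 <= k <= T, which is optimality, and its zero at k = T makes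
    the residual orthogonal to gamma. *)
Let tsum_res_tail k : (l + k <= N)%N ->
  tsum gamma res (l + k) = k%:R * (k%:R + 1) * (T - k%:R) / ((T + 1) * (T + 2)).
Proof.
elim: k => [|k IH] h; first by rewrite addn0 tsum_res // tsum_l !mul0r.
rewrite addnS tsumS // IH ?csumS ?res_tail /tail_line -/T; [|lia..].
rewrite csum_res; last lia.
rewrite gamma_tail; last lia.
rewrite -natr1 natrD -[(gamma _).+1%:R]natr1; field; rewrite -/T; exact/andP.
Qed.

Lemma sum_residual : \sum_(i < N.+1) res i = 0.
Proof.
rewrite -/(csum res N.+1) csumS /res /worst_coord ltnNge (ltnW lN) /= -/res.
rewrite avec_last /tail_line -/T; last lia.
have := csum_res (k := N - l) ltac:(lia); rewrite subnKC; last lia.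
move=> ->; rewrite natrB ?(ltnW lN) // -/T; field; exact/andP.
Qed.

Lemma sum_residual_hinge j : (j <= N)%N -> 0 <= \sum_(i < N.+1) res i * hinge j i.
Proof.
move=> jN; rewrite tsum_bigE //; have [jl|lj] := leqP j l.
  by rewrite tsum_res //; case: (kkt jl).
have := tsum_res_tail (k := j - l) ltac:(lia); rewrite subnKC; last lia.
move=> ->; apply: mulr_ge0; last by rewrite invr_ge0 ltW.
apply: mulr_ge0; first by rewrite mulr_ge0 ?addr_ge0 ?ler0n.
by rewrite subr_ge0 /T natrB ?(ltnW lj) // lerD2r ler_nat.
Qed.

Lemma sum_residual_gamma : \sum_(i < N.+1) res i * g i = 0.
Proof.
rewrite sum_gammaE [csum _ _]sum_residual mulr0 sub0r.
have := tsum_res_tail (k := N - l) ltac:(lia); rewrite subnKC; last lia.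
by move=> ->; rewrite natrB ?(ltnW lN) // -/T subrr mulr0 mul0r oppr0.
Qed.

(* Replacing 2 by the line moves the hinges at l - 1 and l only, and the new
   coefficient at l is still nonnegative because N is large. *)
Definition hinge_coef j : F :=
  s j + (if j == l.-1 then (2 * T - 2) / ((T + 1) * (T + 2)) else 0)
      - (if j == l then 2 / (T + 1) else 0).

Lemma hinge_coef_ge0 j : (j <= l)%N -> 0 <= hinge_coef j.
Proof.
move=> jl; have [sj _ _] := kkt jl; rewrite /hinge_coef.
have h : 0 <= (2 * T - 2) / ((T + 1) * (T + 2)).
  by apply: divr_ge0; [move: T_ge1; lra|exact: ltW].
have [->|jl'] := eqVneq j l.
  have [e|_] := eqVneq l l.-1; first by move: ci_lt_l e; clear; lia.
  by rewrite addr0 subr_ge0.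
by rewrite subr0; case: eqP => _; rewrite ?addr0 // addr_ge0.
Qed.

(** Below l the two corrections, at l - 1 and l, are affine; since these points are one gap apart,
    together they turn the extended tail line into the constant 2. *)
Lemma worst_coordE i : (i <= N)%N ->
  w N i = (tail_line N l + 6 / ((T + 1) * (T + 2)) * g l)
          + (- (6 / ((T + 1) * (T + 2)))) * g i
          + \sum_(j < l.+1) hinge_coef j * hinge j i.
Proof.
move=> iN; have l_gt0 : (0 < l)%N by lia.
have -> : \sum_(j < l.+1) hinge_coef j * hinge j i
   = x i + (2 * T - 2) / ((T + 1) * (T + 2)) * hinge l.-1 i - 2 / (T + 1) * hinge l i.
  have e1 : \sum_(j < l.+1) (if j == l.-1 :> nat then (2 * T - 2) / ((T + 1) * (T + 2)) else 0) * hinge j i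
     = (2 * T - 2) / ((T + 1) * (T + 2)) * hinge l.-1 i.
    have hl : (l.-1 < l.+1)%N by lia.
    rewrite (bigD1 (Ordinal hl)) //= eqxx big1 ?addr0 // => j.
    by rewrite -val_eqE /= => /negbTE->; rewrite mul0r.
  have e2 : \sum_(j < l.+1) (if j == l :> nat then 2 / (T + 1) else 0) * hinge j i
     = 2 / (T + 1) * hinge l i.
    rewrite (bigD1 ord_max) //= eqxx big1 ?addr0 // => j.
    by rewrite -val_eqE /= => /negbTE->; rewrite mul0r.
  rewrite -e1 -e2 -big_split -sumrB /=; apply: eq_bigr => j _; rewrite /hinge_coef.
  by rewrite mulrBl mulrDl.
rewrite /w; case: (ltnP i l) => il.
  rewrite !hingeE //; [|lia..].
  have -> : g l = g l.-1 + 1.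
    by rewrite natr1 -gamma_tail ?prednK //; lia.
  rewrite /tail_line -/T; field; exact/andP.
rewrite !hinge0 //; last lia.
rewrite big1 => [|j _]; last by rewrite hinge0 ?mulr0 // (leq_trans _ il) // -ltnS.
rewrite /tail_line -/T (gamma_l il); field; exact/andP.
Qed.

(** This sign allows a weight vector to be replaced by its convex minorant in the upper bound for
    mu. *)
Lemma worst_coord_ge0 i : (i <= N)%N -> 0 <= w N i.
Proof.
move=> iN; rewrite /worst_coord; case: ltnP => il.
  apply: addr_ge0; first by rewrite ler0n.
  by apply: sumr_ge0 => j _; rewrite mulr_ge0 ?hinge_ge0 //; case: (kkt (ltn_ord j : (j <= l)%N)).
rewrite /tail_line -/T -[2 in X in X + _](mulfK (lt0r_neq0 D_gt0)) -mulrDl.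
apply: divr_ge0; last exact: ltW.
have : i%:R - l%:R <= T by rewrite /T lerD2r ler_nat.
move: (i%:R - l%:R) => y yT; have := T_ge1 => T1.
have : 0 <= T * (T - 1) by apply: mulr_ge0; lra.
lra.
Qed.

Lemma residual_orthogonal : \sum_(i < N.+1) res i * w N i = 0.
Proof.
pose A := tail_line N l + 6 / ((T + 1) * (T + 2)) * g l.
pose B := - (6 / ((T + 1) * (T + 2))).
(* The residual is orthogonal to the affine function that agrees with w from l on. Subtracting it
   leaves a sum over i < l, where complementary slackness applies. *)
have h1 i : (i < N.+1)%N -> w N i = (A + B * g i)
   + (if (i < l)%N then (2 + x i - (A + B * g i)) else 0).
  move=> iN; rewrite /worst_coord; case: ltnP => il; first by ring.
  rewrite /A /B /tail_line -/T (gamma_l il); field; exact/andP.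
rewrite (eq_bigr (fun i : 'I_N.+1 => A * res i + B * (res i * g i)
   + res i * (if (i < l)%N then (2 + x i - (A + B * g i)) else 0))); last first.
  by move=> i _; rewrite {1}h1 //; ring.
rewrite !big_split /= -!mulr_sumr sum_residual sum_residual_gamma !mulr0 !add0r.
have lN' : (l <= N.+1)%N by lia.
rewrite (eq_bigr (fun i : 'I_N.+1 => if (i < l)%N then res i * (2 + x i - (A + B * g i)) else 0));
  last by move=> i _; case: ifP => // _; rewrite mulr0.
rewrite -big_mkcond /= -(big_ord_widen N.+1 (fun i => res i * (2 + x i - (A + B * g i)))) //.
have gE i : (i < l)%N -> g i = g l - hinge l i by move=> il; rewrite hingeE ?(ltnW il) //; ring.
rewrite (eq_bigr (fun i : 'I_l => (2 - A - B * g l) * res i + B * (res i * hinge l i)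
   + \sum_(j < l.+1) s j * (res i * hinge j i))); last first.
  move=> i _; rewrite gE //.
  have -> : \sum_(j < l.+1) s j * (res i * hinge j i) = res i * x i.
    by rewrite mulr_sumr; apply: eq_bigr => j _; ring.
  by ring.
rewrite !big_split /= -!mulr_sumr -/(csum res l) csum_res_l -/(tsum gamma res l) tsum_res //.
rewrite tsum_l !mulr0 !add0r exchange_big big1 //= => j _.
have jl : (j <= l)%N by rewrite -ltnS.
rewrite -mulr_sumr -/(dotp l res (hinge j)) dotp_hinge // tsum_res //.
by case: (kkt jl).
Qed.

End FixedN.
End FiniteProjection.

(** * Polynomial identities over an infinite field, and division by a variable *)

Section Digits.
Local Open Scope nat_scope.

Lemma digits_inj b q (m m' : 'I_q -> nat) :
  (forall i, m i < b) -> (forall i, m' i < b) ->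
  \sum_(i < q) m i * b ^ i = \sum_(i < q) m' i * b ^ i -> m =1 m'.
Proof.
elim: q m m' => [|q IH] m m' hm hm'; first by move=> _ [].
have e (f : 'I_q.+1 -> nat) : \sum_(i < q.+1) f i * b ^ i
   = (\sum_(i < q) f (lift ord0 i) * b ^ i) * b + f ord0.
  rewrite big_ord_recl expn0 muln1 addnC; congr (_ + _).
  by rewrite big_distrl /=; apply: eq_bigr => i _; rewrite /bump add1n expnSr mulnA.
rewrite !e => h.
have h0 : m ord0 = m' ord0.
  by have := congr1 (modn^~ b) h; rewrite !modnMDl !modn_small.
move: h; rewrite h0 => /addIn/eqP; rewrite eqn_pmul2r; last first.
  exact: leq_ltn_trans (leq0n _) (hm ord0).
move=> /eqP/IH h i; case: (unliftP ord0 i) => [j|] -> //.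
by apply: h.
Qed.

End Digits.

Section InfiniteField.
Variable k : closedFieldType.

Lemma poly_fun_eq0 (p : {poly k}) : (forall x, p.[x] = 0) -> p = 0.
Proof.
move=> h; apply/eqP; apply: contraT => /closed_nonrootP[x].
by rewrite /root h eqxx.
Qed.

Lemma poly_fun_neq0_eq0 (p : {poly k}) : (forall x, x != 0 -> p.[x] = 0) -> p = 0.
Proof.
move=> h; have /eqP : 'X * p = 0.
  apply: poly_fun_eq0 => x; rewrite hornerM hornerX.
  by have [->|x0] := eqVneq x 0; [rewrite mul0r|rewrite h ?mulr0].
by rewrite mulf_eq0 polyX_eq0 => /eqP.
Qed.

(** [E] may repeat values, so coefficients are collected by exponent; multiplication by a large
    power of t reduces the claim to polynomials. *)
Lemma laurent_coef_eq0 (I : finType) (kap : I -> k) (E : I -> int) :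
  (forall t, t != 0 -> \sum_i kap i * t ^ E i = 0) ->
  forall e, \sum_(i | E i == e) kap i = 0.
Proof.
move=> h e.
pose b := (`|e| + \sum_i `|E i|)%N.
have Eb i : (0 <= E i + b%:Z).
  have : (`|E i| <= \sum_i `|E i|)%N by rewrite (bigD1 i) //= leq_addr.
  by rewrite /b; lia.
have eb : (0 <= e + b%:Z) by rewrite /b; lia.
pose p : {poly k} := \sum_i kap i *: 'X^(absz (E i + b%:Z)).
have p0 : p = 0.
  apply: poly_fun_neq0_eq0 => t t0; rewrite horner_sum.
  transitivity ((\sum_i kap i * t ^ E i) * t ^ b%:Z).
    rewrite mulr_suml; apply: eq_bigr => i _.
    by rewrite hornerZ hornerXn -mulrA -expfzDr // exprnP gez0_abs ?Eb.
  by rewrite h // mul0r.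
have := congr1 (fun p : {poly k} => p`_(absz (e + b%:Z))) p0.
rewrite coef0 coef_sum => h0.
rewrite -[RHS]h0 [LHS]big_mkcond; apply: eq_bigr => i _ /=; rewrite coefZ coefXn.
have -> : (absz (e + b%:Z) == absz (E i + b%:Z)) = (E i == e).
  have := Eb i; move: eb; clear; lia.
by case: eqP => _; rewrite ?mulr1 ?mulr0.
Qed.

(** Kronecker substitution of x^(b^i) for X_i: b exceeds every exponent in p, so uniqueness of
    digits in base b keeps the monomials apart. *)
Lemma mpoly_fun_eq0 q (p : {mpoly k[q]}) : (forall v, p.@[v] = 0) -> p = 0.
Proof.
move=> h; pose b := msize p.
pose w (m : 'X_{1..q}) := (\sum_(i < q) m i * b ^ i)%N.
pose f : {poly k} := \sum_(m <- msupp p) p@_m *: 'X^(w m).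
have f0 : f = 0.
  apply: poly_fun_eq0 => x; rewrite horner_sum -[RHS](h (fun i => x ^+ (b ^ i))).
  rewrite mevalE; apply: eq_bigr => m _; rewrite hornerZ hornerXn; congr (_ * _).
  rewrite /w (big_morph _ (exprD x) (expr0 x)); apply: eq_bigr => i _.
  by rewrite -exprM mulnC.
apply/mpolyP => m; rewrite mcoeff0; apply/eqP.
rewrite mcoeff_eq0; apply/negP => mp.
have winj m' : m' \in msupp p -> w m' = w m -> m' = m.
  move=> m'p e; apply/mnmP.
  have hb (u : 'X_{1..q}) : u \in msupp p -> forall i, (u i < b)%N.
    move=> /msize_mdeg_lt hu i; apply: leq_ltn_trans hu.
    by rewrite mdegE (bigD1 i) //= leq_addr.
  exact: (digits_inj (hb _ m'p) (hb _ mp) e).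
have := congr1 (fun f : {poly k} => f`_(w m)) f0; rewrite coef0 coef_sum.
rewrite (big_rem m) //= coefZ coefXn eqxx mulr1 big_seq big1 ?addr0 => [e|m' hm'].
  by move: mp; rewrite mcoeff_msupp e eqxx.
rewrite coefZ coefXn; case: eqP => [e|_]; last by rewrite mulr0.
have m'p := mem_rem hm'.
have e' := winj _ m'p (esym e); move: hm'.
by rewrite e' mem_rem_uniqF // msupp_uniq.
Qed.

End InfiniteField.

Section MpolyMorphisms.
Variables (k : comNzRingType) (q : nat).

Lemma mpoly_hom_ext (S : comNzRingType) (f g : {rmorphism {mpoly k[q]} -> S}) :
  (forall c, f c%:MP = g c%:MP) -> (forall i, f 'X_i = g 'X_i) -> f =1 g.
Proof.
move=> hc hX p; rewrite [p]mpolyE !rmorph_sum; apply: eq_bigr => m _.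
rewrite -mul_mpolyC !rmorphM /= hc; congr (_ * _).
rewrite mpolyXE_id !rmorph_prod; apply: eq_bigr => i _.
by rewrite !rmorphXn /= hX.
Qed.

Definition zero_var (i : 'I_q) : {mpoly k[q]} -> {mpoly k[q]} :=
  mmap (@mpolyC q k) (fun j => if j == i then 0 else 'X_j).

HB.instance Definition _ i := GRing.RMorphism.on (zero_var i).

Lemma zero_varE i p : exists p', p = 'X_i * p' + zero_var i p.
Proof.
elim/mpolyind: p => [|c m p _ _ [p' hp]].
  by exists 0; rewrite raddf0 mulr0 addr0.
have [m' hm] : exists m', 'X_[m] = 'X_i * m' + zero_var i 'X_[m].
  case: (posnP (m i)) => [mi|mi].
    exists 0; rewrite mulr0 add0r /zero_var mmapX mpolyXE_id /mmap1.
    apply: eq_bigr => j _; case: eqP => // ->.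
    by rewrite mi !expr0.
  exists 'X_[m - U_(i)]; rewrite -mpolyXD addmC submK ?lep1mP -?lt0n //.
  rewrite /zero_var mmapX /mmap1 (bigD1 i) //= eqxx expr0n.
  by rewrite (gtn_eqF mi) mul0r addr0.
exists (c *: m' + p'); rewrite raddfD /= {1}hp {1}hm.
have -> : zero_var i (c *: 'X_[m]) = c *: zero_var i 'X_[m].
  by rewrite -mul_mpolyC rmorphM /= {1}/zero_var mmapC mul_mpolyC.
rewrite scalerDr mulrDr -scalerAr; ring.
Qed.

End MpolyMorphisms.

(** X_i is prime and does not divide P, so its powers come off Q one by one. This removes the
    leading coefficient introduced by pseudo-division by the resultant. *)
Lemma cancel_var_power (k : fieldType) q (i : 'I_q) M (F Q P : {mpoly k[q]}) :
  'X_i ^+ M * F = Q * P -> zero_var i P != 0 -> exists Q', F = Q' * P.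
Proof.
have X0 : zero_var i 'X_i = 0 :> {mpoly k[q]}.
  by rewrite /zero_var mmapX mmap1U eqxx.
elim: M Q => [|M IH] Q; first by rewrite mul1r => -> _; exists Q.
move=> e P0; have [Q' hQ] := zero_varE i Q.
have Q0 : zero_var i Q = 0.
  have := congr1 (zero_var i) e; rewrite !rmorphM /= rmorphXn /= X0 exprS !mul0r.
  by move=> /esym/eqP; rewrite mulf_eq0 (negbTE P0) orbF => /eqP.
apply: IH P0; apply: (@mulfI _ 'X_i).
  rewrite -msupp_eq0 msuppX //.
by rewrite mulrA -exprS e {1}hQ Q0 addr0 mulrA.
Qed.

(** * The sparse resultant and its weights *)

Lemma sum_half (n : nat) (f : nat -> nat) :
  (\sum_(i < n.*2) f i./2 = 2 * \sum_(r < n) f r)%N.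
Proof.
elim: n => [|n IH]; first by rewrite !big_ord0.
by rewrite doubleS !big_ord_recr /= IH uphalf_double doubleK mulnDr !mul2n -!addnn !addnA.
Qed.

Section SparseResultant.
Variables (gamma : nat -> nat) (N : nat).
Hypothesis gamma_lt : forall i, (gamma i < gamma i.+1)%N.
Hypothesis gamma0 : gamma 0 = 0%N.
Hypothesis N_gt0 : (0 < N)%N.

Local Notation n := (gamma N).

Let gammaN_ge (l : 'I_N.+1) : (gamma l <= n)%N.
Proof. by apply: (gamma_le gamma_lt); rewrite -ltnS. Qed.

Let gammaN_gt0 : (0 < n)%N.
Proof. by rewrite -gamma0 (leq_trans (gamma_lt 0)) // (gamma_le gamma_lt). Qed.

Let half_lt (i : 'I_n.*2) : (i./2 < n)%N.
Proof. by rewrite ltn_half_double. Qed.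

Let col_lt (i : 'I_n.*2) (l : 'I_N.+1) : (i./2 + gamma l < n.*2)%N.
Proof. by have := half_lt i; have := gammaN_ge l; clear; lia. Qed.

Lemma gamma_ltE i j : (gamma i < gamma j)%N = (i < j)%N.
Proof.
apply/idP/idP => [|ij]; last by rewrite (leq_trans (gamma_lt i)) ?(gamma_le gamma_lt).
by apply: contraTT; rewrite -!leqNgt; apply: (gamma_le gamma_lt).
Qed.

Lemma gamma_inj : injective gamma.
Proof.
by move=> i j e; apply/eqP; case: ltngtP => //; rewrite -gamma_ltE e ltnn.
Qed.

Definition row_of (i : nat) : 'I_2 := if odd i then 1 else 0.

(* Sylvester matrix of two polynomials with exponents gamma l, of formal degree
   gamma N; rows 2 r and 2 r + 1 hold x^r f and x^r g. *)
Definition sylv (S : comNzRingType) (A : 'M[S]_(2, N.+1)) : 'M[S]_n.*2 :=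
  \matrix_(i, j) \sum_(l < N.+1) A (row_of i) l *+ (i./2 + gamma l == j).

Definition resx (S : comNzRingType) (A : 'M[S]_(2, N.+1)) : S := \det (sylv A).

(** The vector of powers of x is in the kernel and has entry 1 at index 0; multiplying by the
    adjugate gives the claim even when S has zero divisors. *)
Lemma resx_root (S : comNzRingType) (A : 'M[S]_(2, N.+1)) (x : S) :
  (forall e, \sum_(l < N.+1) A e l * x ^+ gamma l = 0) -> resx A = 0.
Proof.
move=> h; have n2 : (0 < n.*2)%N by rewrite double_gt0.
pose v : 'cV[S]_n.*2 := \col_j x ^+ j.
have sv : sylv A *m v = 0.
  apply/matrixP => i j; rewrite !mxE.
  under eq_bigr => c _ do rewrite !mxE mulr_suml.
  rewrite exchange_big /=.
  transitivity ((\sum_(l < N.+1) A (row_of i) l * x ^+ gamma l) * x ^+ i./2).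
    rewrite mulr_suml.
    apply: eq_bigr => l _.
    rewrite (bigD1 (Ordinal (col_lt i l))) //= eqxx mulr1n big1 ?addr0 => [|c].
      by rewrite exprD; ring.
    by rewrite -val_eqE /= eq_sym => /negbTE->; rewrite mulr0n mul0r.
  by rewrite h mul0r.
have := mul_adj_mx (sylv A) => /(congr1 (fun M => (M *m v) (Ordinal n2) 0)).
by rewrite -mulmxA sv mulmx0 mul_scalar_mx !mxE expr0 mulr1.
Qed.

Lemma resx_map (S S' : comNzRingType) (f : {rmorphism S -> S'}) (A : 'M[S]_(2, N.+1)) :
  f (resx A) = resx (map_mx f A).
Proof.
rewrite /resx -det_map_mx; congr (\det _); apply/matrixP => i j; rewrite !mxE rmorph_sum.
by apply: eq_bigr => l _; rewrite rmorphMn !mxE.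
Qed.

Local Notation choice_fun := {ffun 'I_n.*2 -> 'I_N.+1}.

(** Expanding every row of the determinant chooses one entry [lam i] in row i. The remaining 0-1
    matrix has a single 1 in each row, so its determinant is a sign or 0. *)
Definition lam_sign (S : comNzRingType) (lam : choice_fun) : S :=
  \det (\matrix_(i, j) ((i./2 + gamma (lam i) == j)%N%:R : S)).

Lemma resx_expand (S : comNzRingType) (A : 'M[S]_(2, N.+1)) :
  resx A = \sum_(lam : choice_fun) lam_sign S lam * \prod_(i < n.*2) A (row_of i) (lam i).
Proof.
rewrite /resx /lam_sign /determinant.
under eq_bigr => s _.
  rewrite (eq_bigr (fun i : 'I_n.*2 => \sum_(l < N.+1) A (row_of i) l *+ (i./2 + gamma l == s i))); last first.
    by move=> i _; rewrite mxE.
  rewrite bigA_distr_bigA mulr_sumr; over.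
rewrite exchange_big /=; apply: eq_bigr => lam _; rewrite mulr_suml; apply: eq_bigr => s _.
rewrite -mulrA -big_split /=; congr (_ * _); apply: eq_bigr => i _.
by rewrite mxE mulr_natl.
Qed.

Definition admissible (lam : choice_fun) : Prop :=
  exists s : {perm 'I_n.*2}, forall i : 'I_n.*2, (i./2 + gamma (lam i) = s i)%N.

Lemma lam_sign_admissible (S : comNzRingType) lam : lam_sign S lam != 0 -> admissible lam.
Proof.
rewrite /lam_sign /determinant => h.
have [s] : exists s : {perm 'I_n.*2}, [forall i : 'I_n.*2, (i./2 + gamma (lam i) == s i)%N].
  apply/existsP; apply: contraNT h => /existsPn h; apply/eqP; apply: big1 => s _.
  have /forallPn[i /negbTE hi] := h s.
  by rewrite (bigD1 i) //= mxE hi mul0r mulr0.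
by move=> /forallP hs; exists s => i; apply/eqP.
Qed.

Lemma admissible_lam_sign (S : comNzRingType) lam : admissible lam ->
  exists b : bool, lam_sign S lam = (-1) ^+ b.
Proof.
move=> [s hs]; exists s; rewrite -det_perm; congr (\det _); apply/matrixP => i j.
by rewrite !mxE hs val_eqE eq_sym.
Qed.

Lemma admissible_inj (lam : choice_fun) :
  injective (fun i : 'I_n.*2 => (i./2 + gamma (lam i))%N) -> admissible lam.
Proof.
move=> h.
pose f i := Ordinal (col_lt i (lam i)).
have f_inj : injective f by move=> i j /(congr1 val) /h.
by exists (perm f_inj) => i; rewrite permE.
Qed.

(** The selected columns exhaust 0, ..., 2n - 1; subtract the shifts [i./2] from their sum. *)
Lemma admissible_sum (lam : choice_fun) : admissible lam ->
  (\sum_(i < n.*2) gamma (lam i) = n ^ 2)%N.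
Proof.
move=> [s hs].
have : (\sum_(i < n.*2) (i./2 + gamma (lam i)) = \sum_(c < n.*2) c)%N.
  by rewrite [RHS](reindex_inj (@perm_inj _ s)) /=; apply: eq_bigr => i _; rewrite hs.
rewrite big_split /= (sum_half n id) /=.
have e1 m : (2 * \sum_(c < m) c + m = m * m)%N.
  elim: m => [|m IH]; rewrite ?big_ord0 // big_ord_recr /=.
  by move: (\sum_(c < m) c)%N IH => a; clear; nia.
rewrite -mulnn; have := e1 n; have := e1 n.*2.
move: (\sum_(c < n) c)%N (\sum_(c < n.*2) c)%N (\sum_(i < n.*2) gamma (lam i))%N => a b c.
by move: n; clear; nia.
Qed.

(** The equality case of [admissible_hinge]: [gamma (lam i)] and the unit interval starting at
    [i./2] lie on the same side of [kap]. *)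
Definition tight (lam : choice_fun) (kap : nat) (i : 'I_n.*2) : bool :=
  ~~ ((gamma (lam i) < kap)%N && (kap <= i./2)%N)
  && ~~ ((i./2 < kap)%N && (kap < gamma (lam i))%N).

(* Convexity of (K - x)_+ for the sums 2 gamma (lam i) + (2 r + 1) = 2 c + 1, where
   c is the column selected in row i. *)
Lemma admissible_hinge (lam : choice_fun) kap : admissible lam -> (kap <= n)%N ->
  (kap ^ 2 <= \sum_(i < n.*2) (kap - gamma (lam i)) ?= iff [forall i, tight lam kap i])%N.
Proof.
move=> [s hs] kn.
(* With truncated subtraction, [lhs c] is the positive part of 4 kap - (2c + 1), and [rhs i] adds
   the positive parts of 2 kap - 2 gamma (lam i) and 2 kap - (2r + 1), r = [i./2]. The termwise
   bound is subadditivity, an equality unless the two arguments have opposite signs. *)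
pose lhs (c : nat) := ((2 * kap - c) + (2 * kap - c.+1))%N.
pose rhs (i : 'I_n.*2) := ((2 * (kap - gamma (lam i))) + (2 * kap - (2 * i./2).+1))%N.
have h : (\sum_(i < n.*2) lhs (s i) <= \sum_(i < n.*2) rhs i ?= iff [forall i, tight lam kap i])%N.
  apply: leqif_sum => i _; rewrite /lhs /rhs /tight -hs.
  split; first by clear; lia.
  by clear; apply/eqP/idP; lia.
have e1 : (\sum_(i < n.*2) lhs (s i) = 4 * kap ^ 2)%N.
  rewrite -(reindex_inj (@perm_inj _ s) (P := xpredT) (F := fun c : 'I_n.*2 => lhs c)) /=.
  have e m : (\sum_(c < m) lhs c + (2 * kap - m) ^ 2 = (2 * kap) ^ 2)%N.
    elim: m => [|m IH]; first by rewrite big_ord0 subn0.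
    rewrite big_ord_recr /= -[RHS]IH /lhs -addnA; congr (_ + _)%N.
    rewrite subnS; case: (2 * kap - m)%N => // d; rewrite -!mulnn /=; nia.
  have := e n.*2; have -> : (2 * kap - n.*2 = 0)%N by move: kn; clear; lia.
  by rewrite expnMn addn0 => ->.
have e2 : (\sum_(i < n.*2) rhs i = 2 * \sum_(i < n.*2) (kap - gamma (lam i)) + 2 * kap ^ 2)%N.
  rewrite big_split /= -big_distrr /=; congr (_ + _)%N.
  rewrite (sum_half n (fun r => 2 * kap - (2 * r).+1)%N); congr (_ * _)%N.
  have e m : (\sum_(r < m) (2 * kap - (2 * r).+1) + (kap - m) ^ 2 = kap ^ 2)%N.
    elim: m => [|m IH]; first by rewrite big_ord0 subn0.
    rewrite big_ord_recr /= -[RHS]IH -addnA; congr (_ + _)%N.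
    case E: (kap - m)%N => [|d]; rewrite -!mulnn.
      have -> : (kap - m.+1 = 0)%N by move: E; clear; lia.
      by have -> : (2 * kap - (2 * m).+1 = 0)%N by move: E; clear; lia.
    have -> : (kap - m.+1 = d)%N by move: E; clear; lia.
    have -> : (2 * kap - (2 * m).+1 = (2 * d).+1)%N by move: E; clear; lia.
    by clear; nia.
  have := e n; have -> : (kap - n = 0)%N by move: kn; clear; lia.
  by rewrite addn0.
move: h; rewrite e1 e2 => -[h1 h2]; split; first by move: h1; clear; lia.
rewrite -h2; move: (\sum_(i < n.*2) _)%N (kap ^ 2)%N => a b; clear.
by apply/eqP/eqP; lia.
Qed.

(** * Chains of exponents and their terms in the resultant *)

Section Chain.
Variable B : {set 'I_N.+1}.
Hypothesis B0 : ord0 \in B.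
Hypothesis BN : ord_max \in B.

Definition chain_lo (r : nat) : 'I_N.+1 :=
  [arg max_(l > ord0 | (l \in B) && (gamma l <= r)%N) (l : nat)].
Definition chain_hi (r : nat) : 'I_N.+1 :=
  [arg min_(l < ord_max | (l \in B) && (r < gamma l)%N) (l : nat)].
Definition chain_rank (l : 'I_N.+1) : nat := #|[set p in B | (p < l)%N]|.

Lemma chain_loP r : [/\ chain_lo r \in B, (gamma (chain_lo r) <= r)%N
  & forall p, p \in B -> (gamma p <= r)%N -> (p <= chain_lo r)%N].
Proof.
rewrite /chain_lo; case: arg_maxnP => [|l /andP[lB lr] lmax]; first by rewrite B0 gamma0.
by split=> // p pB pr; apply: lmax; rewrite pB.
Qed.

Lemma chain_hiP r : (r < n)%N -> [/\ chain_hi r \in B, (r < gamma (chain_hi r))%N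
  & forall p, p \in B -> (r < gamma p)%N -> (chain_hi r <= p)%N].
Proof.
move=> rn; rewrite /chain_hi; case: arg_minnP => [|l /andP[lB lr] lmin]; first by rewrite BN.
by split=> // p pB pr; apply: lmin; rewrite pB.
Qed.

Lemma chain_rank_hi r : (r < n)%N -> chain_rank (chain_hi r) = (chain_rank (chain_lo r)).+1.
Proof.
move=> rn; have [l1 l2 l3] := chain_loP r; have [h1 h2 h3] := chain_hiP rn.
have -> : chain_rank (chain_hi r) = #|chain_lo r |: [set p in B | (p < chain_lo r)%N]|.
  apply: eq_card => p; rewrite !inE.
  have [->|pl] := eqVneq p (chain_lo r); first by rewrite l1 -gamma_ltE (leq_ltn_trans l2).
  case pB: (p \in B) => //=.
  rewrite -val_eqE in pl; apply/idP/idP => [ph|pl'].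
    rewrite ltn_neqAle pl /=.
    by apply: l3 => //; rewrite leqNgt; apply: contraL ph => /(h3 _ pB); rewrite -leqNgt.
  by apply: (ltn_trans pl'); rewrite -gamma_ltE (leq_ltn_trans l2).
by rewrite cardsU1 inE ltnn andbF.
Qed.

(* The chain monomial: row 2 r or 2 r + 1 uses the end of parity 0 or 1 of the edge
   of the chain above r. *)
Definition chain_fun : choice_fun :=
  [ffun i : 'I_n.*2 => if odd (chain_rank (chain_lo i./2)) == odd i
                       then chain_lo i./2 else chain_hi i./2].

Lemma chain_fun_odd (i : 'I_n.*2) :
  (chain_fun i \in B) && (odd (chain_rank (chain_fun i)) == odd i).
Proof.
have [l1 _ _] := chain_loP i./2; have [h1 _ _] := chain_hiP (half_lt i).
rewrite ffunE; case: ifP => [->|]; first by rewrite l1.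
rewrite h1 chain_rank_hi //=.
by case: (odd _); case: (odd i).
Qed.

(** On an edge between exponents p and q, the rows using p select the columns of [2p, p + q) and
    those using q the columns of [p + q, 2q). Different edges therefore give disjoint intervals [2p,
    2q). *)
Lemma chain_fun_admissible : admissible chain_fun.
Proof.
apply: admissible_inj => i i' /= e.
have [l1 l2 l3] := chain_loP i./2; have [h1 h2 h3] := chain_hiP (half_lt i).
have [l1' l2' l3'] := chain_loP i'./2; have [h1' h2' h3'] := chain_hiP (half_lt i').
have eB (j : 'I_n.*2) : (gamma (chain_lo j./2) + gamma (chain_lo j./2) <= j./2 + gamma (chain_fun j)
     < gamma (chain_hi j./2) + gamma (chain_hi j./2))%N.
  have [_ p2 _] := chain_loP j./2; have [_ q2 _] := chain_hiP (half_lt j).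
  by rewrite ffunE; case: ifP => _; move: p2 q2; clear; lia.
have ei := eB i; have ei' := eB i'; rewrite -e in ei'.
have lolo : chain_lo i./2 = chain_lo i'./2.
  apply/val_inj/eqP; rewrite /= eqn_leq; apply/andP; split.
    apply: l3' => //; rewrite leqNgt; apply/negP => /(h3' _ l1) /(gamma_le gamma_lt).
    by move: ei ei'; clear; lia.
  apply: l3 => //; rewrite leqNgt; apply/negP => /(h3 _ l1') /(gamma_le gamma_lt).
  by move: ei ei'; clear; lia.
have hihi : chain_hi i./2 = chain_hi i'./2.
  apply/val_inj/eqP; rewrite /= eqn_leq; apply/andP; split.
    apply: h3 => //; rewrite ltnNge; apply/negP => /(l3 _ h1') /(gamma_le gamma_lt).
    by move: ei ei'; clear; lia.
  apply: h3' => //; rewrite ltnNge; apply/negP => /(l3' _ h1) /(gamma_le gamma_lt).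
  by move: ei ei'; clear; lia.
move: e; rewrite !ffunE -lolo -hihi.
have oi := odd_double_half i; have oi' := odd_double_half i'.
move: l2 h2 l2' h2'; rewrite -lolo -hihi => l2 h2 l2' h2'.
case: eqP => o1; case: eqP => o2 e; apply/val_inj => /=.
- by move: e; rewrite -oi -oi' -o1 -o2; clear; lia.
- by move: e l2 l2' h2 h2'; clear; lia.
- by move: e l2 l2' h2 h2'; clear; lia.
have : odd i = odd i' by move: o1 o2; case: (odd (chain_rank _)); case: (odd i); case: (odd i').
by move=> o; move: e; rewrite -oi -oi' o; clear; lia.
Qed.

Lemma chain_fun_tight p (i : 'I_n.*2) : p \in B -> tight chain_fun (gamma p) i.
Proof.
move=> pB; have [l1 l2 l3] := chain_loP i./2; have [h1 h2 h3] := chain_hiP (half_lt i).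
rewrite /tight; apply/andP; split; apply/negP => /andP[a b].
  have pl : (gamma p <= gamma (chain_lo i./2))%N by apply/(gamma_le gamma_lt)/l3.
  by move: a b pl l2 h2; rewrite ffunE; case: ifP => _; clear; lia.
have hp : (gamma (chain_hi i./2) <= gamma p)%N by apply/(gamma_le gamma_lt)/h3.
by move: a b hp l2 h2; rewrite ffunE; case: ifP => _; clear; lia.
Qed.

(** Tightness at both ends of the edge above [i./2] leaves only these ends for [lam i], and their
    ranks have opposite parities. *)
Lemma chain_fun_unique (lam : choice_fun) :
  (forall i : 'I_n.*2, (lam i \in B) && (odd (chain_rank (lam i)) == odd i)) ->
  (forall p (i : 'I_n.*2), p \in B -> tight lam (gamma p) i) -> lam = chain_fun.
Proof.
move=> lamB lamT; apply/ffunP => i.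
have [l1 l2 l3] := chain_loP i./2; have [h1 h2 h3] := chain_hiP (half_lt i).
have /andP[iB /eqP io] := lamB i.
have /andP[t1 _] := lamT _ i l1; have /andP[_ t2] := lamT _ i h1.
have : (lam i == chain_lo i./2) || (lam i == chain_hi i./2).
  rewrite -!val_eqE /=; have [le|lt] := leqP (gamma (lam i)) i./2.
    apply/orP; left; rewrite eqn_leq l3 //= leqNgt; apply/negP => hlt.
    by move: t1; rewrite l2 andbT gamma_ltE hlt.
  apply/orP; right; rewrite eqn_leq andbC h3 //= leqNgt; apply/negP => hlt.
  by move: t2; rewrite h2 gamma_ltE hlt.
rewrite ffunE => /orP[/eqP e|/eqP e]; move: io; rewrite e.
  by move=> ->; rewrite eqxx.
rewrite chain_rank_hi //= => <-.
by case: (odd _).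
Qed.

(** An auxiliary convex weight that breaks at the points of B. By [admissible_hinge] its total over
    an admissible choice is minimal exactly when the choice is tight at every point of B. *)
Definition chain_weight (l : nat) : nat := (\sum_(p in B) (gamma p - gamma l))%N.

Lemma chain_weight_unique (lam : choice_fun) : admissible lam ->
  (forall i : 'I_n.*2, (lam i \in B) && (odd (chain_rank (lam i)) == odd i)) ->
  (\sum_(i < n.*2) chain_weight (lam i) = \sum_(i < n.*2) chain_weight (chain_fun i))%N ->
  lam = chain_fun.
Proof.
move=> adm lamB e; apply: chain_fun_unique => // p i pB.
have chainE : (\sum_(i < n.*2) chain_weight (chain_fun i) = \sum_(p in B) (gamma p) ^ 2)%N.
  rewrite /chain_weight exchange_big /=; apply: eq_bigr => q qB.
  have [_ /esym] := admissible_hinge chain_fun_admissible (gammaN_ge q).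
  have -> : [forall i, tight chain_fun (gamma q) i].
    by apply/forallP => j; apply: chain_fun_tight.
  by move/esym/eqP => <-.
have h : (\sum_(q in B) (gamma q) ^ 2 <= \sum_(q in B) \sum_(i < n.*2) (gamma q - gamma (lam i))
     ?= iff [forall (q | q \in B), [forall i, tight lam (gamma q) i]])%N.
  by apply: leqif_sum => q _; apply: admissible_hinge.
have [_] := h; rewrite exchange_big /= -/chain_weight.
move: e; rewrite chainE /chain_weight => ->; rewrite eqxx => /esym/forall_inP/(_ p pB)/forallP.
exact.
Qed.

End Chain.

Lemma prod_alternate (S : comNzRingType) (x y : S) m :
  \prod_(i < m.*2) (if odd i then x else y) = (x * y) ^+ m.
Proof.
elim: m => [|m IH]; first by rewrite big_ord0.
by rewrite doubleS !big_ord_recr /= IH odd_double /= exprS; ring.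
Qed.

Lemma sum_alternate a b m :
  (\sum_(i < m.*2) (if odd i then a else b) = (a + b) * m)%N.
Proof.
elim: m => [|m IH]; first by rewrite big_ord0 muln0.
by rewrite doubleS !big_ord_recr /= IH odd_double /= mulnS; clear; lia.
Qed.

Definition other_row (e : 'I_2) : 'I_2 := if e == 0 then 1 else 0.

(** The n rows of the constant polynomial take exponent 0; since the exponents sum to n^2, each of
    the other n rows must take the maximal exponent n. *)
Lemma resx_two_point (S : comNzRingType) (A : 'M[S]_(2, N.+1)) (e : 'I_2) :
  (forall l, l != ord0 -> A e l = 0) ->
  exists b : bool, resx A = (-1) ^+ b * (A e ord0 * A (other_row e) ord_max) ^+ n.
Proof.
move=> Ae.
pose lam1 : choice_fun := [ffun i : 'I_n.*2 => if row_of i == e then ord0 else ord_max].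
have eE : e = 0 \/ e = 1.
  by case: e {Ae lam1} => [[|[|//]]] h; [left|right]; apply/val_inj.
have adm : admissible lam1.
  apply: admissible_inj => i i' /=; rewrite !ffunE.
  have oi := odd_double_half i; have oi' := odd_double_half i'.
  have := half_lt i; have := half_lt i'.
  move=> h1 h2 h3; apply/val_inj => /=; rewrite -oi -oi'.
  have [o h] : odd i = odd i' /\ i./2 = i'./2; last by rewrite o h.
  move: h3; rewrite /row_of; case: eE => ->; case: (odd i); case: (odd i');
    rewrite /= ?gamma0; move: h1 h2; clear; lia.
have [b hb] := admissible_lam_sign S adm.
exists b; rewrite resx_expand (bigD1 lam1) //= hb [X in _ + X]big1 ?addr0.
  congr (_ * _); under eq_bigr => i _ do rewrite ffunE /row_of.
  case: eE => ->; rewrite /other_row /=.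
    by rewrite [A 0 _ * _]mulrC -prod_alternate; apply: eq_bigr => i _; case: (odd i).
  by rewrite -prod_alternate; apply: eq_bigr => i _; case: (odd i).
move=> lam lam_neq; have [->|/lam_sign_admissible admlam] := eqVneq (lam_sign S lam) 0.
  by rewrite mul0r.
have [/forallP h0|/forallPn[i]] := boolP [forall i : 'I_n.*2, (row_of i == e) ==> (lam i == ord0)];
  last first.
  rewrite negb_imply => /andP[/eqP hi hl].
  by rewrite (bigD1 i) //= hi Ae // mul0r mulr0.
case/negP: lam_neq; apply/eqP/ffunP => i; rewrite ffunE.
case: ifP => hi; first by have := h0 i; rewrite hi => /eqP.
pose m (j : 'I_n.*2) := if row_of j == e then 0%N else n.
have h : (\sum_(j < n.*2) gamma (lam j) <= \sum_(j < n.*2) m j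
    ?= iff [forall j : 'I_n.*2, gamma (lam j) == m j])%N.
  apply: leqif_sum => j _; split=> //; rewrite /m; case: ifP => // hj.
  by have := h0 j; rewrite hj => /eqP->; rewrite gamma0.
have hm : (\sum_(j < n.*2) m j = n ^ 2)%N.
  rewrite /m /row_of; case: eE => ->.
    transitivity ((n + 0) * n)%N; last by rewrite addn0 mulnn.
    by rewrite -sum_alternate; apply: eq_bigr => j _; case: (odd j).
  transitivity ((0 + n) * n)%N; last by rewrite add0n mulnn.
  by rewrite -sum_alternate; apply: eq_bigr => j _; case: (odd j).
have [_] := h; rewrite (admissible_sum admlam) hm eqxx => /esym/forallP/(_ i).
by rewrite /m hi => /eqP/gamma_inj => e'; apply/val_inj.
Qed.

End SparseResultant.

(** * The Chow form of the monomial curve is the sparse resultant *)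

Section PolyDegrees.
Variable R : comNzRingType.

Lemma coef_mul_top (p p' : {poly R}) a b : (size p <= a.+1)%N -> (size p' <= b.+1)%N ->
  (p * p')`_(a + b) = p`_a * p'`_b.
Proof.
move=> pa pb; rewrite coefM.
have ha : (a < (a + b).+1)%N by rewrite ltnS leq_addr.
rewrite (bigD1 (Ordinal ha)) //= addKn big1 ?addr0 // => j.
rewrite -val_eqE /= neq_ltn => /orP[ja|ja].
  by rewrite [p'`_ _]nth_default ?mulr0 // (leq_trans pb) //; move: ja; clear; lia.
by rewrite [p`_ _]nth_default ?mul0r // (leq_trans pa).
Qed.

Lemma size_coef_prod (I : finType) (p : I -> {poly R}) (d : I -> nat) :
  (forall i, (size (p i) <= (d i).+1)%N) ->
  (size (\prod_i p i)%R <= (\sum_i d i).+1)%N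
  /\ (\prod_i p i)`_(\sum_i d i) = \prod_i (p i)`_(d i).
Proof.
move=> h.
elim/big_rec3: _ => [|i c e P _ [s1 s2]]; first by rewrite size_poly1 coef1.
split; last by rewrite coef_mul_top // s2.
apply: leq_trans (size_polyMleq _ _) _; have := h i; move: s1; clear; lia.
Qed.

Lemma size_coef_det m (M : 'M[{poly R}]_m) (d : 'I_m -> nat) :
  (forall i j, (size (M i j) <= (d i).+1)%N) ->
  (size (\det M) <= (\sum_i d i).+1)%N
  /\ (\det M)`_(\sum_i d i) = \det (\matrix_(i, j) (M i j)`_(d i)).
Proof.
move=> h; have hs (s : {perm 'I_m}) := size_coef_prod (fun i => h i (s i)).
have sgn (s : {perm 'I_m}) : (-1) ^+ s = ((-1) ^+ s)%:P :> {poly R} by rewrite rmorphXn rmorphN1.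
split.
  apply: (leq_trans (size_sum _ _ _)); apply/bigmax_leqP => s _.
  by rewrite sgn mul_polyC (leq_trans (size_scale_leq _ _)) //; case: (hs s).
rewrite /determinant coef_sum; apply: eq_bigr => s _.
rewrite sgn coefCM (hs s).2; congr (_ * _).
by apply: eq_bigr => i _; rewrite mxE.
Qed.

End PolyDegrees.

Lemma det2 (R : comNzRingType) (M : 'M[R]_2) :
  \det M = M 0 0 * M 1 1 - M 0 1 * M 1 0.
Proof.
rewrite (expand_det_row _ 0) !big_ord_recl big_ord0 addr0 /cofactor !det_mx11 !mxE /=.
rewrite expr0 mul1r expr1 mulN1r mulrN; congr (_ * M _ _ - M _ _ * M _ _); exact/val_inj.
Qed.

(** * Relations between polynomials of degrees n and n - 1 *)

Section AlgebraicIndependence.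
Variable k : fieldType.

Lemma sum_distinct_sizes m (a : 'I_m -> {poly k}) :
  (forall i j, a i != 0 -> a j != 0 -> size (a i) = size (a j) -> i = j) ->
  \sum_i a i = 0 -> forall i, a i = 0.
Proof.
move=> inj s0 i; apply/eqP; apply: contraT => ai0.
pose j := [arg max_(j > i | a j != 0) size (a j)].
have [aj0 jmax] : a j != 0 /\ forall l, a l != 0 -> (size (a l) <= size (a j))%N.
  by rewrite /j; case: arg_maxnP.
have := congr1 (fun p : {poly k} => p`_(size (a j)).-1) s0.
rewrite coef0 coef_sum (bigD1 j) //= big1 => [|l lj].
  by rewrite addr0 => /eqP; rewrite -lead_coefE lead_coef_eq0 (negbTE aj0).
have [->|al0] := eqVneq (a l) 0; first by rewrite coef0.
apply: nth_default; rewrite -ltnS prednK ?size_poly_gt0 // ltn_neqAle jmax // andbT.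
by apply: contra lj => /eqP /(inj _ _ al0 aj0)/eqP.
Qed.

(** The nonzero summands have degrees n deg r_j + j (n - 1), distinct modulo n, so leading terms
    cannot cancel. *)
Lemma powers_independent n (g h : {poly k}) (r : 'I_n -> {poly k}) :
  size g = n.+1 -> size h = n ->
  \sum_(j < n) (r j \Po g) * h ^+ j = 0 -> forall j, r j = 0.
Proof.
move=> sg sh s0 j.
have n_gt0 : (0 < n)%N by apply: leq_ltn_trans (ltn_ord j).
have h0 : h != 0 by rewrite -size_poly_gt0 sh.
have sr i : r i != 0 -> size ((r i \Po g) * h ^+ i) = ((size (r i)).-1 * n + i * n.-1).+1%N.
  move=> ri0; have rg : r i \Po g != 0.
    rewrite -size_poly_gt0 -(size_comp_poly2 _ (q := 'X)) ?size_polyX // comp_polyXr.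
    rewrite size_poly_gt0; apply: contra ri0 => /eqP e.
    by move/eqP: e; rewrite comp_poly_eq0 // sg ltnS.
  have hi0 : h ^+ i != 0 by rewrite expf_neq0.
  rewrite size_mul // -(prednK (_ : (0 < size (r i \Po g))%N)) ?size_poly_gt0 //.
  rewrite size_comp_poly sg /= -(prednK (_ : (0 < size (h ^+ i))%N)) ?size_poly_gt0 //.
  by rewrite size_exp sh addnS /= mulnC [(i * _)%N]mulnC; clear; lia.
have e i : (r i \Po g) * h ^+ i != 0 -> r i != 0.
  by apply: contraNneq => ->; rewrite comp_poly0 mul0r.
have := sum_distinct_sizes _ s0 j => /(_ _)/eqP.
rewrite mulf_eq0 (negbTE (expf_neq0 _ h0)) orbF => H.
apply/eqP; rewrite -(@comp_poly_eq0 _ _ g) ?sg ?ltnS //; apply: H.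
move=> i i' /e ri /e ri'; rewrite !sr // => -[E].
have E' : (((size (r i)).-1 + i) * n + i' = ((size (r i')).-1 + i') * n + i)%N.
  have en (a : nat) : (a * n = a * n.-1 + a)%N by rewrite -mulnSr prednK.
  move: E; rewrite !mulnDl (en i) (en i').
  move: ((size (r i)).-1 * n)%N ((size (r i')).-1 * n)%N => a a'.
  move: (i * n.-1)%N (i' * n.-1)%N (nat_of_ord i) (nat_of_ord i') => b b' c c'.
  by clear; lia.
apply/val_inj => /=; have := congr1 (modn^~ n) E'.
by rewrite !modnMDl !modn_small.
Qed.

(** Translating the outer variable of r by [lam] times the inner one preserves the outer degree and
    replaces f by f - lam g, of degree n - 1. *)
Lemma powers_independent_shift n (lam : k) (g f : {poly k}) (r : {poly {poly k}}) :
  size g = n.+1 -> size (f - lam *: g) = n -> (size r <= n)%N ->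
  (map_poly (comp_poly g) r).[f] = 0 -> r = 0.
Proof.
move=> sg sh sr r0; pose r' := r \Po ('X + (lam *: 'X)%:P).
have sr' : size r' = size r.
  by rewrite /r' size_comp_poly2 // size_XaddC.
apply/eqP; rewrite -size_poly_eq0 -sr' size_poly_eq0.
have r'0 : (map_poly (comp_poly g) r').[f - lam *: g] = 0.
  rewrite /r' map_comp_poly horner_comp rmorphD /= map_polyX map_polyC /=.
  by rewrite comp_polyZ comp_polyX hornerD hornerX hornerC subrK.
have e : \sum_(j < n) (r'`_j \Po g) * (f - lam *: g) ^+ j = 0.
  rewrite -[RHS]r'0 (@horner_coef_wide _ n).
    by apply: eq_bigr => j _; rewrite coef_map.
  by rewrite (leq_trans (size_poly _ _)) // sr'.
apply/eqP/polyP => j; rewrite coef0.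
have [jn|nj] := ltnP j n; last by rewrite nth_default // sr' (leq_trans sr).
exact: (powers_independent sg sh e (Ordinal jn)).
Qed.

End AlgebraicIndependence.

Lemma rmorph_remainder (R S : comNzRingType) (phi : {rmorphism {poly R} -> S}) c p q p' r :
  c *: p = q * p' + r -> phi p = 0 -> phi p' = 0 -> phi r = 0.
Proof.
move=> /(congr1 phi) + p0 p'0; rewrite -mul_polyC rmorphD !rmorphM /= p0 p'0.
by rewrite !mulr0 add0r.
Qed.

Lemma horner_division (R : comNzRingType) (y c : R) (p q p' r : {poly R}) :
  c *: p = q * p' + r -> r = 0 -> c * p.[y] = q.[y] * p'.[y].
Proof.
move=> /(congr1 (horner^~ y)) /= e r0.
by move: e; rewrite r0 addr0 hornerZ hornerM.
Qed.

Section ChowFormIsResultant.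
Variables (k : closedFieldType) (gamma : nat -> nat) (N : nat).
Hypothesis gamma_lt : forall i, (gamma i < gamma i.+1)%N.
Hypothesis gamma0 : gamma 0 = 0%N.
Hypothesis N_gt1 : (1 < N)%N.
Hypothesis gammaN : gamma N = (gamma N.-1).+1.

Local Notation n := (gamma N).
Local Notation P := {mpoly k[2 * N.+1]}.
Local Notation resx := (@resx gamma N _).

Let N_gt0 : (0 < N)%N. Proof. exact: ltnW. Qed.
Let n_gt0 : (0 < n)%N. Proof. by rewrite gammaN. Qed.

Definition ev_mx (S : comNzRingType) (f : {rmorphism k -> S}) (A : 'M[S]_(2, N.+1)) : P -> S :=
  mmap f (fun i => mxvec A 0 i).

HB.instance Definition _ S f A := GRing.RMorphism.on (@ev_mx S f A).

Lemma ev_mxX S f A e l : @ev_mx S f A (coef_mx k N.+1 e l) = A e l.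
Proof. by rewrite /ev_mx mxE mmapX mmap1U mxvecE. Qed.

Lemma ev_mxC S f A c : @ev_mx S f A c%:MP = f c.
Proof. exact: mmapC. Qed.

Lemma ev_mx_resx S f A : @ev_mx S f A (resx (coef_mx k N.+1)) = resx A.
Proof.
rewrite resx_map; congr resx; apply/matrixP => e l.
by rewrite mxE /= ev_mxX.
Qed.

Lemma ev_mx_ext (S : comNzRingType) (f g : {rmorphism P -> S}) :
  (forall c, f c%:MP = g c%:MP) ->
  (forall e l, f (coef_mx k N.+1 e l) = g (coef_mx k N.+1 e l)) -> f =1 g.
Proof.
move=> hc hX; apply: mpoly_hom_ext => // i.
by case/mxvec_indexP: i => e l; have := hX e l; rewrite mxE.
Qed.

Lemma eval_mxE F A : eval_mx F A = ev_mx idfun A F.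
Proof. by []. Qed.

Variable F : P.
Hypothesis F_irr : irreducible_mpoly F.
Hypothesis F_root : forall (A : 'M[k]_(2, N.+1)) x, \rank A = 2%N ->
  (forall e, \sum_(l < N.+1) A e l * x ^+ gamma l = 0) -> eval_mx F A = 0.

Let lN1 : 'I_N.+1 := inord N.-1.

Let lN1E : lN1 = N.-1 :> nat.
Proof. by rewrite inordK // ltnS leq_pred. Qed.

(** When it is nonzero, A has rank 2, and eliminating x^n between the two polynomials leaves degree
    exactly n - 1. *)
Definition top_minor (S : comNzRingType) (A : 'M[S]_(2, N.+1)) : S :=
  A 0 lN1 * A 1 ord_max - A 0 ord_max * A 1 lN1.

Lemma rank_top_minor (A : 'M[k]_(2, N.+1)) : top_minor A != 0 -> \rank A = 2%N.
Proof.
move=> h; pose f (j : 'I_2) := if j == 0 then lN1 else ord_max.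
have e : colsub f A = A *m colsub f 1%:M by rewrite mulmx_colsub mulmx1.
apply/eqP; rewrite eqn_leq rank_leq_row /=.
have : (\rank (colsub f A) <= \rank A)%N by rewrite e mxrankM_maxl.
suff -> : \rank (colsub f A) = 2%N by [].
apply: mxrank_unit; rewrite unitmxE unitfE det2 !mxE /f /=.
by move: h; rewrite /top_minor.
Qed.

(* With a_0 as main variable, the resultant has leading coefficient b_N^n up to sign. *)
Let thmx : 'M[{poly P}]_(2, N.+1) :=
  \matrix_(e, l) if (e == 0) && (l == ord0) then 'X else (coef_mx k N.+1 e l)%:P.
Let th : {rmorphism P -> {poly P}} := ev_mx (@polyC P \o @mpolyC _ k) thmx.

Let bN : P := coef_mx k N.+1 1 ord_max.

Lemma th_resx : exists b : bool,
  (size (th (resx (coef_mx k N.+1))) <= n.+1)%N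
  /\ (th (resx (coef_mx k N.+1)))`_n = (-1) ^+ b * bN ^+ n.
Proof.
rewrite /th /= ev_mx_resx.
pose d (i : 'I_n.*2) := if odd i then 0%N else 1%N.
have sumd : (\sum_i d i = n)%N by rewrite sum_alternate mul1n.
(* Rows of f have degree at most 1 in a_0, the others degree 0. The coefficient of a_0^n is thus the
   resultant with f replaced by 1. *)
pose A1 : 'M[P]_(2, N.+1) :=
  \matrix_(e, l) if e == 0 then (l == ord0)%:R else coef_mx k N.+1 1 l.
have [] := @size_coef_det _ _ (sylv gamma thmx) d.
  move=> i j; rewrite mxE; apply: (leq_trans (size_sum _ _ _)); apply/bigmax_leqP => l _.
  rewrite mulrb; case: ifP => _; last by rewrite size_poly0.
  rewrite mxE /row_of /d.
  by case: (odd i) => /=; [|case: ifP]; rewrite ?size_polyX // (leq_trans (size_polyC_leq1 _)).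
rewrite sumd => h1 h2.
have A10 l : l != ord0 -> A1 0 l = 0 by move=> l0; rewrite mxE /= (negbTE l0).
have [b hb] := resx_two_point gamma_lt gamma0 A10.
exists b; split=> //; rewrite h2.
  have -> : \matrix_(i, j) (sylv gamma thmx i j)`_(d i) = sylv gamma A1.
    apply/matrixP => i j; rewrite !mxE coef_sum; apply: eq_bigr => l _.
    rewrite coefMn !mxE /row_of /d; case: (odd i) => /=; first by rewrite coefC.
    by case: eqP => _; rewrite ?coefX ?coefC.
  have e1 : A1 0 ord0 = 1 by rewrite mxE.
  have e2 : A1 (other_row 0) ord_max = bN by rewrite mxE.
  by rewrite -/(resx A1) hb e1 e2 mul1r.
Qed.

Lemma th_specialize (S : comNzRingType) (f : {rmorphism P -> S}) (y : S) (p : P) :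
  (map_poly f (th p)).[y]
  = ev_mx (f \o @mpolyC _ k)
      (\matrix_(e, l) if (e == 0) && (l == ord0) then y else f (coef_mx k N.+1 e l)) p.
Proof.
pose g1 : {rmorphism P -> S} := horner_eval y \o (map_poly f \o th).
pose g2 : {rmorphism P -> S} := ev_mx (f \o @mpolyC _ k)
      (\matrix_(e, l) if (e == 0) && (l == ord0) then y else f (coef_mx k N.+1 e l)).
apply: (@ev_mx_ext _ g1 g2) => [c|e l].
  by rewrite /g1 /g2 /th /= !ev_mxC /= map_polyC /horner_eval hornerC.
rewrite /g1 /g2 /th /= !ev_mxX /horner_eval [in LHS]mxE [in RHS]mxE.
by case: ifP => _; rewrite ?map_polyX ?map_polyC ?hornerX ?hornerC.
Qed.

Lemma th_horner p : (th p).[coef_mx k N.+1 0 ord0] = p.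
Proof.
have := th_specialize idfun (coef_mx k N.+1 0 ord0) p; rewrite map_poly_id // => ->.
pose g1 : {rmorphism P -> P} := ev_mx (idfun \o @mpolyC _ k) 
  (\matrix_(e, l) if (e == 0) && (l == ord0) then coef_mx k N.+1 0 ord0 else idfun (coef_mx k N.+1 e l)).
apply: (@ev_mx_ext _ g1 idfun) => [c|e l]; first by rewrite /g1 /= ev_mxC.
by rewrite /g1 /= ev_mxX mxE /=; case: ifP => // /andP[/eqP-> /eqP->].
Qed.

(* Restricting to a pencil x |-> (f - f(x), g - g(x)) turns the remainder into a
   polynomial relation of small degree between two polynomials of coprime degrees. *)
Lemma remainder_eq0 (q r : {poly P}) c :
  c *: th F = q * th (resx (coef_mx k N.+1)) + r -> (size r <= n)%N -> r = 0.
Proof.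
move=> defF sr.
(* It is enough to evaluate where b_N and the top minor are nonzero, since their product is a
   nonzero polynomial. *)
suff h j A : (bN * top_minor (coef_mx k N.+1)).@[fun i => mxvec A 0 i] * (r`_j).@[fun i => mxvec A 0 i] = 0.
  apply/polyP => j; rewrite coef0; apply/eqP.
  have nz : bN * top_minor (coef_mx k N.+1) != 0.
    pose A0 : 'M[k]_(2, N.+1) := \matrix_(e, l) if e == 0 then (l == lN1)%:R else (l == ord_max)%:R.
    apply/eqP => /(congr1 (ev_mx idfun A0)); rewrite rmorph0 rmorphM rmorphB !rmorphM /= !ev_mxX !mxE /= !eqxx.
    have -> : (lN1 == ord_max) = false by apply/negbTE; rewrite -val_eqE /= lN1E; move: N_gt1; clear; lia.
    by rewrite !(mul1r, mulr0, subr0) => /eqP; rewrite oner_eq0.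
  have /eqP : bN * top_minor (coef_mx k N.+1) * r`_j = 0.
    apply: mpoly_fun_eq0 => v; rewrite mevalM.
    have := h j (vec_mx (\row_i v i)); rewrite vec_mxK.
    rewrite (@meval_eq _ _ _ v) => [|i]; last by rewrite mxE.
    by rewrite (@meval_eq _ _ (fun i => (\row_i v i) 0 i) v) // => i; rewrite mxE.
  by rewrite mulf_eq0 (negbTE nz).
have [->|] := eqVneq ((bN * top_minor (coef_mx k N.+1)).@[fun i => mxvec A 0 i]) 0; first by rewrite mul0r.
rewrite -[_.@[_]]/(ev_mx idfun A (bN * top_minor (coef_mx k N.+1))).
rewrite rmorphM rmorphB !rmorphM /= !ev_mxX mulf_eq0 => /norP[ANz tmz].
pose g1 : {poly k} := - \sum_(l < N.+1 | l != ord0) A 1 l *: 'X^(gamma l).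
pose f1 : {poly k} := - \sum_(l < N.+1 | l != ord0) A 0 l *: 'X^(gamma l).
(* [nu] specializes all coefficients to A except b_0, kept as the variable; [mu] then puts b_0 =
   g1(x), and evaluating at a_0 = f1(x) gives the pencil. *)
pose nu : {rmorphism P -> {poly k}} := ev_mx polyC
  (\matrix_(e, l) if (e == 1) && (l == ord0) then 'X else (A e l)%:P).
pose mu : {rmorphism P -> {poly k}} := comp_poly g1 \o nu.
have coef_f1 e m (l0 : 'I_N.+1) : l0 != ord0 -> gamma l0 = m ->
    (- \sum_(l < N.+1 | l != ord0) A e l *: 'X^(gamma l))`_m = - A e l0.
  move=> l00 <-; rewrite coefN coef_sum (bigD1 l0) //= big1 ?addr0.
    by rewrite coefZ coefXn eqxx mulr1.
  move=> l /andP[_ ll0]; rewrite coefZ coefXn.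
  case: eqP => [/(gamma_inj gamma_lt) E|_]; last by rewrite mulr0.
  by case/eqP: ll0; apply/val_inj.
have max0 : ord_max != ord0 :> 'I_N.+1 by rewrite -val_eqE /= -lt0n.
have lN10 : lN1 != ord0 by rewrite -val_eqE /= lN1E; move: N_gt1; clear; lia.
have size_le e : (size (- \sum_(l < N.+1 | l != ord0) A e l *: 'X^(gamma l)) <= n.+1)%N.
  rewrite size_polyN; apply: (leq_trans (size_sum _ _ _)); apply/bigmax_leqP => l _.
  rewrite (leq_trans (size_scale_leq _ _)) // size_polyXn ltnS.
  by apply: (gamma_le gamma_lt); rewrite -ltnS.
have sg1 : size g1 = n.+1.
  apply/eqP; rewrite eqn_leq size_le /= ltnNge; apply/negP => /leq_sizeP/(_ n (leqnn _)).
  by rewrite (coef_f1 1 n ord_max) // => /eqP; rewrite oppr_eq0 (negbTE ANz).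
pose lam := A 0 ord_max / A 1 ord_max.
have sf1 : size (f1 - lam *: g1) = n.
  have hle : (size (f1 - lam *: g1)%R <= n)%N.
    apply/leq_sizeP => i; rewrite leq_eqVlt => /orP[/eqP<-|nj].
      rewrite coefB coefZ (coef_f1 1 n ord_max) // (coef_f1 0 n ord_max) // /lam.
      by rewrite mulrN divfK // subrr.
    by rewrite coefB coefZ !nth_default ?mulr0 ?subr0 // (leq_trans (size_le _)).
  apply/eqP; rewrite eqn_leq hle /= leqNgt gammaN ltnS; apply/negP => /leq_sizeP/(_ _ (leqnn _)).
  rewrite coefB coefZ (coef_f1 1 _ lN1) ?lN1E // (coef_f1 0 _ lN1) ?lN1E // /lam => /eqP h.
  case/eqP: tmz; move/eqP: h => h.
  have -> : A 0 lN1 * A 1 ord_max - A 0 ord_max * A 1 lN1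
     = - A 1 ord_max * (- A 0 lN1 - A 0 ord_max / A 1 ord_max * - A 1 lN1) by field.
  by rewrite h mulr0.
(* both polynomials vanish at the generic point x of the curve *)
pose Ax : 'M[{poly k}]_(2, N.+1) := \matrix_(e, l) if l == ord0 then (if e == 0 then f1 else g1) else (A e l)%:P.
have muE p : (map_poly mu (th p)).[f1] = ev_mx polyC Ax p.
  rewrite th_specialize.
  pose h1 : {rmorphism P -> {poly k}} := ev_mx (mu \o @mpolyC _ k)
    (\matrix_(e, l) if (e == 0) && (l == ord0) then f1 else mu (coef_mx k N.+1 e l)).
  pose h2 : {rmorphism P -> {poly k}} := ev_mx polyC Ax.
  apply: (@ev_mx_ext _ h1 h2) => [a|e l].
    by rewrite /h1 /h2 /= !ev_mxC /= ev_mxC comp_polyC.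
  rewrite /h1 /h2 /= !ev_mxX [in LHS]mxE [in RHS]mxE /= ev_mxX [X in X \Po _]mxE.
  have e01 : (e == 0) || (e == 1) by case: e => [[|[|]]].
  case: (l == ord0) => /=; rewrite ?andbT ?andbF ?comp_polyC //.
  by case/orP: e01 => /eqP-> /=; rewrite ?comp_polyX.
have rowE e : \sum_(l < N.+1) Ax e l * 'X ^+ gamma l = 0.
  rewrite (bigD1 ord0) //= mxE eqxx gamma0 expr0 mulr1.
  rewrite (eq_bigr (fun l : 'I_N.+1 => A e l *: 'X^(gamma l))); last first.
    by move=> l l0; rewrite mxE (negbTE l0) mul_polyC.
  have e01 : (e == 0) || (e == 1) by case: e => [[|[|]]].
  by case/orP: e01 => /eqP-> /=; rewrite addNr.
have F0 : ev_mx polyC Ax F = 0.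
  apply: poly_fun_eq0 => x.
  pose B : 'M[k]_(2, N.+1) := map_mx (horner_eval x) Ax.
  have -> : (ev_mx polyC Ax F).[x] = eval_mx F B.
    pose h1 : {rmorphism P -> k} := horner_eval x \o ev_mx polyC Ax.
    pose h2 : {rmorphism P -> k} := ev_mx idfun B.
    rewrite -[LHS]/(h1 F) eval_mxE; apply: (@ev_mx_ext _ h1 h2) => [a|e l].
      by rewrite /h1 /h2 /= !ev_mxC /horner_eval hornerC.
    by rewrite /h1 /h2 /= !ev_mxX /B [in RHS]mxE.
  apply: (F_root (x := x)).
    apply: rank_top_minor; rewrite /top_minor !mxE /= (negbTE max0) (negbTE lN10).
    by rewrite /horner_eval !hornerC.
  move=> e; have := congr1 (horner_eval x) (rowE e); rewrite rmorph0 rmorph_sum /= => h.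
  rewrite -[RHS]h; apply: eq_bigr => l _.
  by rewrite rmorphM rmorphXn /= [horner_eval x 'X]hornerX mxE.
have rmu : (map_poly mu r).[f1] = 0.
  have [phi [phiE phi_th]] : exists phi : {rmorphism {poly P} -> {poly k}},
      (forall p, phi p = (map_poly mu p).[f1]) /\ forall p, phi (th p) = ev_mx polyC Ax p.
    by exists (horner_eval f1 \o map_poly mu); split.
  rewrite -phiE; apply: (rmorph_remainder defF); rewrite phi_th ?F0 //.
  by rewrite ev_mx_resx (resx_root gamma_lt gamma0 N_gt0 rowE).
have nur : map_poly nu r = 0.
  apply: (powers_independent_shift sg1 sf1); first by rewrite (leq_trans (size_poly _ _)).
  by rewrite -map_poly_comp.
have := congr1 (fun p : {poly {poly k}} => (p`_j).[A 1 ord0]) nur.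
rewrite coef_map coef0 horner0 /= => e.
suff -> : (r`_j).@[fun i => mxvec A 0 i] = (nu (r`_j)).[A 1 ord0] by rewrite e mulr0.
pose h1 : {rmorphism P -> k} := ev_mx idfun A.
pose h2 : {rmorphism P -> k} := horner_eval (A 1 ord0) \o nu.
apply: (@ev_mx_ext _ h1 h2) => [a|e' l].
  by rewrite /h1 /h2 /nu /= !ev_mxC /horner_eval hornerC.
rewrite /h1 /h2 /nu /= !ev_mxX mxE /horner_eval.
by case: ifP => [/andP[/eqP-> /eqP->]|_]; rewrite ?hornerX ?hornerC.
Qed.

(** Pseudo-division in a_0 has remainder 0, so after cancelling powers of b_N the resultant divides
    F. It vanishes at A = 0, hence is not a unit, and irreducibility makes the cofactor a
    constant. *)
Lemma chow_form_resx : exists2 c : k, c != 0 & F = c *: resx (coef_mx k N.+1).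
Proof.
pose Rs := resx (coef_mx k N.+1); have [b [h1 h2]] := th_resx.
have bN0 : bN != 0 by rewrite /bN mxE -msupp_eq0 msuppX.
have lc0 : (th Rs)`_n != 0 by rewrite h2 mulf_neq0 ?signr_eq0 ?expf_neq0.
have sR : size (th Rs) = n.+1.
  by apply/eqP; rewrite eqn_leq h1 /= ltnNge; apply: contra lc0 => /leq_sizeP->.
have R0 : th Rs != 0 by rewrite -size_poly_gt0 sR.
have lcE : lead_coef (th Rs) = (-1) ^+ b * bN ^+ n by rewrite lead_coefE sR.
have [M [q [r [defF sr]]]] : exists M q r,
    lead_coef (th Rs) ^+ M *: th F = q * th Rs + r /\ (size r < size (th Rs))%N.
  exists (Pdiv.Idomain.scalp (th F) (th Rs)), (Pdiv.Idomain.divp (th F) (th Rs)),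
    (Pdiv.Idomain.modp (th F) (th Rs)).
  by rewrite Pdiv.Idomain.ltn_modp R0; split=> //; apply: Pdiv.Idomain.divp_eq.
have r0 : r = 0.
  by apply: (remainder_eq0 defF); rewrite -ltnS -sR.
pose y := coef_mx k N.+1 0 ord0.
have eF : lead_coef (th Rs) ^+ M * F = q.[y] * Rs.
  transitivity (lead_coef (th Rs) ^+ M * (th F).[y]).
    by congr (_ * _); symmetry; exact: th_horner.
  transitivity (q.[y] * (th Rs).[y]); last by congr (_ * _); exact: th_horner.
  exact: horner_division defF r0.
have iX : bN = 'X_(mxvec_index 1 ord_max) by rewrite /bN mxE.
have [Q hQ] : exists Q, F = Q * Rs.
  apply: (@cancel_var_power _ _ (mxvec_index 1 ord_max) (n * M) F
     ((-1) ^+ (b * M)%N * q.[y])).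
    by rewrite -mulrA -eF lcE exprMn -!exprM -!mulrA signrMK iX.
  (* with b_N = 0, take f = x^n and g = 1 *)
  pose A0 : 'M[k]_(2, N.+1) := \matrix_(e, l) if e == 0 then (l == ord_max)%:R else (l == ord0)%:R.
  have max0 : (ord_max == ord0 :> 'I_N.+1) = false by apply/negbTE; rewrite -val_eqE /= -lt0n.
  apply/eqP => /(congr1 (ev_mx idfun A0)); rewrite rmorph0.
  pose g1 : {rmorphism P -> k} := ev_mx idfun A0 \o zero_var (mxvec_index 1 ord_max).
  pose g2 : {rmorphism P -> k} := ev_mx idfun A0.
  have -> : ev_mx idfun A0 (zero_var (mxvec_index 1 ord_max) Rs) = ev_mx idfun A0 Rs.
    apply: (@ev_mx_ext _ g1 g2) => [a|e l].
      by rewrite /g1 /g2 /= /zero_var mmapC.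
    rewrite /g1 /g2 /= /zero_var {1}mxE mmapX mmap1U.
    case: eqP => [E|_]; last by rewrite [in RHS]mxE.
    have [-> ->] : e = 1 /\ l = ord_max.
      by move/enum_rank_inj: (cast_ord_inj E) => -[-> ->].
    by rewrite rmorph0 ev_mxX mxE /= max0.
  have A01 l : l != ord0 -> A0 1 l = 0 by move=> l0; rewrite mxE /= (negbTE l0).
  rewrite ev_mx_resx; have [b' ->] := resx_two_point gamma_lt gamma0 A01.
  by rewrite /other_row !mxE /= !eqxx mul1r expr1n mulr1 => /eqP; rewrite signr_eq0.
have [_ _ /(_ _ _ hQ)] := F_irr; case=> [Qu|Ru].
  have [/eqP QC Q0] := andP Qu.
  exists Q@_0; first by rewrite -unitfE.
  by rewrite hQ {1}QC mul_mpolyC.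
have := mulVr Ru => /(congr1 (ev_mx idfun 0)); rewrite rmorphM rmorph1 /= ev_mx_resx.
rewrite (@resx_root gamma N gamma_lt gamma0 N_gt0 _ 0 0) ?mulr0 => [/esym/eqP|e].
  by rewrite oner_eq0.
by apply: big1 => l _; rewrite mxE mul0r.
Qed.

End ChowFormIsResultant.

(** * Hilbert-Mumford weights of the Chow form *)

Section DiagonalOnePS.
Variables (k : closedFieldType) (n : nat).

Lemma mul_diag_ps p (A : 'M[k]_(p, n)) v t e l :
  (A *m diag_ps v t) e l = A e l * t ^ v 0 l.
Proof. by rewrite /diag_ps mul_mx_diag !mxE. Qed.

Lemma one_ps_diag (v : 'rV[int]_n) : one_ps (diag_ps (k := k) v).
Proof.
split=> [t t0|s t s0 t0|].
- rewrite unitmxE det_diag unitfE; apply/prodf_neq0 => i _.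
  by rewrite mxE expfz_neq0.
- by apply/matrixP => i j; rewrite mul_diag_ps !mxE expfzMl mulrnAl; case: eqP => // ->.
pose b := (\sum_i absz (v 0%R i))%N.
exists b, (\matrix_(i, j) (if i == j then 'X^(absz (v 0 j + b%:Z)) else 0)) => t t0.
apply/matrixP => i j; rewrite !mxE.
case: eqP => [->|_]; last by rewrite mulr0n mulr0 horner0.
have vb : (0 <= v 0 j + b%:Z).
  have : (absz (v 0%R j) <= b)%N by rewrite /b (bigD1 j) //= leq_addr.
  by clear; lia.
by rewrite hornerXn mulr1n [RHS]exprnP gez0_abs // expfzDr // mulrC.
Qed.

Lemma conj_diag_diag (v : 'rV[int]_n) : conj_diag (diag_ps (k := k) v) v.
Proof. by exists 1%:M; rewrite ?unitmx1 // => t _; rewrite mul1mx invmx1 mulmx1. Qed.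

Lemma eval_gl_act (g : 'M[k]_n) G (A : 'M[k]_(2, n)) :
  eval_mx (gl_act g G) A = eval_mx G (A *m g).
Proof.
rewrite /eval_mx /gl_act /subst_mx comp_mpoly_meval; apply: meval_eq => i.
rewrite tnth_mktuple; case/mxvec_indexP: i => e l; rewrite !mxvecE !mxE.
rewrite raddf_sum; apply: eq_bigr => j _ /=.
by rewrite mevalM !mxE mevalXU mevalC mxvecE.
Qed.

Lemma eval_mx_ext (G G' : {mpoly k[2 * n]}) :
  (forall A, eval_mx G A = eval_mx G' A) -> G = G'.
Proof.
move=> h; apply/eqP; rewrite -subr_eq0; apply/eqP/mpoly_fun_eq0 => v.
have := h (vec_mx (\row_i v i)); rewrite /eval_mx vec_mxK.
rewrite !(@meval_eq _ _ (fun i => (\row_i v i) 0 i) v) => [|i|i]; rewrite ?mxE //.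
by move=> e; rewrite mevalB e subrr.
Qed.

End DiagonalOnePS.

Section ChowWeights.
Variables (k : closedFieldType) (gamma : nat -> nat) (N : nat).
Hypothesis gamma_lt : forall i, (gamma i < gamma i.+1)%N.
Hypothesis gamma0 : gamma 0 = 0%N.
Hypothesis N_gt0 : (0 < N)%N.

Local Notation n := (gamma N).
Local Notation P := {mpoly k[2 * N.+1]}.
Local Notation choice_fun := {ffun 'I_n.*2 -> 'I_N.+1}.

Variables (F : P) (c : k).
Hypothesis c_neq0 : c != 0.
Hypothesis defF : F = c *: resx gamma (coef_mx k N.+1).

Definition choice_weight (v : 'rV[int]_N.+1) (lam : choice_fun) : int :=
  \sum_(i < n.*2) v 0 (lam i).

Let term (A : 'M[k]_(2, N.+1)) (lam : choice_fun) : k :=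
  c * (lam_sign k lam * \prod_(i < n.*2) A (row_of i) (lam i)).

Let eval_F A : eval_mx F A = \sum_lam term A lam.
Proof.
rewrite defF eval_mxE -mul_mpolyC rmorphM /= ev_mxC ev_mx_resx resx_expand mulr_sumr.
by [].
Qed.

Let term_diag A v t lam : t != 0 ->
  term (A *m diag_ps v t) lam = term A lam * t ^ choice_weight v lam.
Proof.
move=> t0; rewrite /term -!mulrA; congr (_ * (_ * _)).
rewrite /choice_weight (big_morph (fun e => t ^ e) (fun a b => expfzDr a b t0) (expr0z t)).
by rewrite -big_split /=; apply: eq_bigr => i _; rewrite mul_diag_ps.
Qed.

(** Weight components are unique: the determinant expansion and the given decomposition, the latter
    with a minus sign, form one Laurent sum in t that vanishes identically. *)
Lemma hilbert_mumford_terms v (s : seq int) (C : int -> P) :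
  uniq s -> F = \sum_(i <- s) C i ->
  (forall i, i \in s -> C i != 0 /\
     forall t, t != 0 -> gl_act (diag_ps v t) (C i) = t ^ i *: C i) ->
  forall A e, \sum_(lam | choice_weight v lam == e) term A lam
     = if e \in s then eval_mx (C e) A else 0.
Proof.
move=> us sumF hC A e.
pose I := (choice_fun + 'I_(size s))%type.
pose kap (x : I) := match x with inl lam => term A lam
  | inr j => - eval_mx (C (nth 0 s j)) A end.
pose E (x : I) := match x with inl lam => choice_weight v lam | inr j => nth 0 s j end.
have h t : t != 0 -> \sum_x kap x * t ^ E x = 0.
  move=> t0; rewrite big_sumType /=.
  have -> : \sum_lam term A lam * t ^ choice_weight v lam = eval_mx F (A *m diag_ps v t).
    by rewrite eval_F; apply: eq_bigr => lam _; rewrite term_diag.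
  rewrite -eval_gl_act sumF.
  have -> : gl_act (diag_ps v t) (\sum_(i <- s) C i) = \sum_(i <- s) t ^ i *: C i.
    rewrite /gl_act /subst_mx raddf_sum /=; apply: eq_big_seq => i /hC[_ /(_ t t0)].
    by [].
  rewrite /eval_mx raddf_sum /= (big_nth 0) big_mkord -big_split /=; apply: big1 => j _.
  by rewrite mevalZ; ring.
have := laurent_coef_eq0 h e; rewrite big_sumType /= => /eqP.
rewrite addr_eq0 => /eqP ->; rewrite sumrN opprK.
case: ifP => es; last first.
  apply: big1 => j /eqP E1; case/negP: (negbT es).
  by rewrite -E1 mem_nth.
have ei : (index e s < size s)%N by rewrite index_mem.
rewrite (big_pred1 (Ordinal ei)) /= ?nth_index // => j.
apply/eqP/eqP => [E1|->]; last by rewrite /= nth_index.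
by apply/val_inj; rewrite /= -E1 index_uniq.
Qed.

(** It suffices that the component of weight e is nonzero. Otherwise its value on a suitable curve
    of matrices would vanish, although there the chain term alone contributes to its power of t. *)
Lemma hilbert_mumford_le v m (B : {set 'I_N.+1}) : ord0 \in B -> ord_max \in B ->
  hilbert_mumford F (diag_ps v) m -> m <= choice_weight v (chain_fun gamma B).
Proof.
move=> B0 BN [s [C [us sumF hC ms mmin]]].
set e := choice_weight v _; have [/mmin //|es] := boolP (e \in s).
pose valid (lam : choice_fun) :=
  [forall i : 'I_n.*2, (lam i \in B) && (odd (chain_rank B (lam i)) == odd i)].
pose wt (lam : choice_fun) := (\sum_(i < n.*2) chain_weight gamma B (lam i))%N.
pose kap lam := if (choice_weight v lam == e) && valid lam then c * lam_sign k lam else 0.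
have h t : t != 0 -> \sum_lam kap lam * t ^ (wt lam)%:Z = 0.
  move=> t0.
  (* Entry l survives only in the row given by the parity of its rank, and the powers of t record
     [chain_weight]; [chain_weight_unique] then isolates the chain term. *)
  pose A : 'M[k]_(2, N.+1) := \matrix_(r, l)
    if (l \in B) && (odd (chain_rank B l) == (r == 1)) then t ^+ chain_weight gamma B l else 0.
  have := hilbert_mumford_terms us sumF hC A e; rewrite (negbTE es) => hA.
  rewrite -[RHS]hA [RHS]big_mkcond; apply: eq_bigr => lam _ /=.
  rewrite /kap; case: eqP => _ /=; last by rewrite mul0r.
  have row1 (i : 'I_n.*2) : (row_of i == 1) = odd i by rewrite /row_of; case: (odd i).
  case: ifP => [/forallP hv|/negbT /forallPn[i hi]].
    rewrite /term -exprnP /wt (big_morph _ (exprD t) (expr0 t)) mulrA; congr (_ * _).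
    by apply: eq_bigr => i _; rewrite mxE row1 hv.
  rewrite mul0r /term (bigD1 i) //= mxE row1 (negbTE hi).
  by rewrite mul0r !mulr0.
have := laurent_coef_eq0 h (wt (chain_fun gamma B))%:Z.
have adm := chain_fun_admissible gamma_lt gamma0 B0 BN.
rewrite (bigD1 (chain_fun gamma B)) //= [X in _ + X]big1 => [|lam /andP[/eqP [ew] ne]].
  rewrite addr0 /kap eqxx /=.
  have -> : valid (chain_fun gamma B).
    by apply/forallP => i; apply: chain_fun_odd.
  have [b ->] := admissible_lam_sign k adm.
  by move/eqP; rewrite mulf_eq0 (negbTE c_neq0) signr_eq0.
rewrite /kap; case: ifP => // /andP[_ /forallP hv].
have [->|/lam_sign_admissible a] := eqVneq (lam_sign k lam) 0; first by rewrite mulr0.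
case/eqP: ne; exact: chain_weight_unique.
Qed.

Lemma hilbert_mumford_choice v m : hilbert_mumford F (diag_ps v) m ->
  exists2 lam : choice_fun, admissible lam & m = choice_weight v lam.
Proof.
move=> [s [C [us sumF hC ms _]]].
have [Cm _] := hC m ms.
have hA := hilbert_mumford_terms us sumF hC; rewrite /= in hA.
case: (pickP (fun lam : choice_fun => (lam_sign k lam != 0) && (choice_weight v lam == m))).
  by move=> lam /andP[/lam_sign_admissible ? /eqP ?]; exists lam.
move=> none; case/eqP: Cm; apply: eval_mx_ext => A.
have := hA A m; rewrite ms => <-; rewrite [RHS]/eval_mx meval0; apply: big1 => lam hl.
have := none lam; rewrite /= hl andbT => /negbFE/eqP.
by rewrite /term => ->; rewrite mul0r mulr0.
Qed.

Lemma hilbert_mumford_exists v : exists m, hilbert_mumford F (diag_ps v) m.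
Proof.
pose C e : P := c *: \sum_(lam | choice_weight v lam == e)
   lam_sign P lam * \prod_(i < n.*2) coef_mx k N.+1 (row_of i) (lam i).
have evalC e A : eval_mx (C e) A = \sum_(lam | choice_weight v lam == e) term A lam.
  rewrite eval_mxE /C -mul_mpolyC rmorphM /= ev_mxC rmorph_sum mulr_sumr; apply: eq_bigr => lam _.
  rewrite rmorphM rmorph_prod /=; congr (_ * (_ * _)).
    rewrite /lam_sign -det_map_mx; congr (\det _); apply/matrixP => i j.
    by rewrite !mxE rmorph_nat.
  by apply: eq_bigr => i _; rewrite ev_mxX.
pose s := [seq e <- undup [seq choice_weight v lam | lam : choice_fun] | C e != 0].
have sP e : e \in s -> C e != 0 by rewrite mem_filter => /andP[].
have us : uniq s by rewrite filter_uniq // undup_uniq.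
have sumF : F = \sum_(i <- s) C i.
  rewrite big_filter big_mkcond /=.
  rewrite (eq_bigr C) => [|e _]; last by case: eqP.
  apply: eval_mx_ext => A; rewrite eval_F eval_mxE rmorph_sum /=.
  rewrite (eq_bigr (fun e => \sum_(lam | choice_weight v lam == e) term A lam)); last first.
    by move=> e _; rewrite -evalC.
  rewrite (exchange_big_dep xpredT) //=; apply: eq_bigr => lam _.
  rewrite (big_rem (choice_weight v lam)) /=; last first.
    by rewrite mem_undup map_f // mem_enum.
  rewrite eqxx big_seq_cond big1 ?addr0 // => e /andP[er /eqP ee].
  by move: er; rewrite ee mem_rem_uniqF ?undup_uniq.
have F0 : F != 0.
  pose A0 : 'M[k]_(2, N.+1) := \matrix_(e, l) if e == 0 then (l == ord0)%:R else (l == ord_max)%:R.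
  have A00 l : l != ord0 -> A0 0 l = 0 by move=> l0; rewrite mxE /= (negbTE l0).
  have [b hb] := resx_two_point gamma_lt gamma0 A00.
  apply/eqP => /(congr1 (ev_mx idfun A0)); rewrite rmorph0 defF -mul_mpolyC rmorphM /= ev_mxC.
  rewrite ev_mx_resx hb /other_row !mxE /= !eqxx mulr1 expr1n mulr1 => /eqP.
  by rewrite mulf_eq0 (negbTE c_neq0) signr_eq0.
have s0 : s != [::].
  by apply: contraNneq F0 => s0; rewrite sumF s0 big_nil.
have [m ms mmin] : exists2 m, m \in s & forall i, i \in s -> m <= i.
  case: s s0 {sP us sumF} => // a s _.
  elim: s a => [|b s IH] a; first by exists a; rewrite ?mem_head // => i; rewrite inE => /eqP->.
  have [m ms mmin] := IH b; have [am|ma] := leP a m.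
    exists a; rewrite ?mem_head // => i; rewrite inE => /orP[/eqP->//|/mmin].
    exact: le_trans.
  exists m; first by rewrite inE ms orbT.
  by move=> i; rewrite inE => /orP[/eqP->|/mmin//]; apply: ltW.
exists m, s, C; split=> // e es; split; first exact: sP.
move=> t t0; apply: eval_mx_ext => A.
rewrite eval_gl_act evalC [RHS]eval_mxE -mul_mpolyC rmorphM /= ev_mxC -eval_mxE evalC mulr_sumr.
by apply: eq_bigr => lam /eqP el; rewrite term_diag // el mulrC.
Qed.

End ChowWeights.

(** * The worst one-parameter subgroup *)

(** With a = |w| and b = |v|, the sum of the squares (v_i a - w_i b)^2 is 2ab(ab - <w, v>), hence
    nonpositive. *)
Lemma cauchy_schwarz_eq (R : rcfType) n (w v : 'I_n -> R) :
  Num.sqrt (\sum_i w i ^+ 2) * Num.sqrt (\sum_i v i ^+ 2) <= \sum_i w i * v i ->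
  forall i, v i * Num.sqrt (\sum_i w i ^+ 2) = w i * Num.sqrt (\sum_i v i ^+ 2).
Proof.
set a := Num.sqrt (\sum_i w i ^+ 2); set b := Num.sqrt _ => h i.
have aE : a ^+ 2 = \sum_i w i ^+ 2 by rewrite sqr_sqrtr // sumr_ge0 // => ? _; apply: sqr_ge0.
have bE : b ^+ 2 = \sum_i v i ^+ 2 by rewrite sqr_sqrtr // sumr_ge0 // => ? _; apply: sqr_ge0.
have ab : 0 <= a * b by rewrite mulr_ge0 ?sqrtr_ge0.
have e : \sum_i (v i * a - w i * b) ^+ 2 = 2 * (a * b) * (a * b - \sum_i w i * v i).
  transitivity (a ^+ 2 * (\sum_i v i ^+ 2) - 2 * (a * b) * (\sum_i w i * v i)
      + b ^+ 2 * (\sum_i w i ^+ 2)).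
    rewrite !mulr_sumr -sumrB -big_split /=; apply: eq_bigr => j _; ring.
  by rewrite -aE -bE; ring.
have /eqP : \sum_i (v i * a - w i * b) ^+ 2 = 0.
  apply/eqP; rewrite eq_le sumr_ge0 ?andbT => [|j _]; last exact: sqr_ge0.
  by rewrite e; apply: mulr_ge0_le0; [exact: mulr_ge0|rewrite subr_le0].
rewrite psumr_eq0 => [/allP/(_ i (mem_index_enum _))|j _]; last exact: sqr_ge0.
by rewrite /= sqrf_eq0 subr_eq0 => /eqP.
Qed.

(** Turns a multiple of the rational vector w into integral weights. *)
Lemma common_denominator n (x : 'I_n -> rat) :
  exists (K : nat) (z : 'I_n -> int), (0 < K)%N /\ forall i, (z i)%:~R = K%:R * x i.
Proof.
pose K := \prod_i denq (x i).
have K0 : 0 < K by apply: prodr_gt0 => i _; exact: denq_gt0.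
exists (absz K), (fun i => numq (x i) * \prod_(j | j != i) denq (x j)); split=> [|i].
  by rewrite absz_gt0 gt_eqF.
have -> : (absz K)%:R = K%:~R :> rat by rewrite pmulrn gez0_abs ?ltW.
by rewrite /K [X in _ = X%:~R * _](bigD1 i) //= !intrM numqE; ring.
Qed.

(** * The enumeration of a numerical semigroup *)

Section SemigroupSequence.
Variables (G : pred nat) (gamma : nat -> nat) (ci : nat).
Hypothesis hG : numerical_semigroup G.
Hypothesis hsing : exists n, ~~ G n.
Hypothesis hgamma : enumerates G gamma.
Hypothesis hci : is_conductor G (gamma ci).

Lemma enum_lt i : (gamma i < gamma i.+1)%N.
Proof. by case: hgamma => h _; apply: h. Qed.

Lemma enum_in i : G (gamma i).
Proof. by case: hgamma => _ h; apply/h; exists i. Qed.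

Lemma enum0 : gamma 0 = 0%N.
Proof.
case: hG hgamma => G0 _ _ [_ h]; have [i hi] := (h 0%N).1 G0.
by apply/eqP; rewrite -leqn0 -{2}hi; apply: (gamma_le enum_lt).
Qed.

Lemma enum_tail i : (ci <= i)%N -> gamma i.+1 = (gamma i).+1.
Proof.
move=> ii; have Gi : G (gamma i).+1.
  by case: hci => h _; apply: h; rewrite leqW // (gamma_le enum_lt).
case: hgamma => _ h; have [j hj] := (h _).1 Gi.
have ij : (i < j)%N by rewrite -(gamma_ltE enum_lt) hj.
by apply/eqP; rewrite eqn_leq enum_lt andbT -hj; apply: (gamma_le enum_lt).
Qed.

Lemma conductor_index_gt0 : (0 < ci)%N.
Proof.
rewrite lt0n; apply/eqP => c0; case: hsing => m; case: hci => h _.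
by rewrite h // c0 enum0.
Qed.

Lemma enum_gap : ((gamma ci.-1).+2 <= gamma ci)%N.
Proof.
rewrite ltnNge; apply/negP => h; case: hci => h1 h2.
have e : gamma ci = (gamma ci.-1).+1.
  apply/eqP; rewrite eqn_leq h /=.
  by have := enum_lt ci.-1; rewrite prednK ?conductor_index_gt0.
suff /h2 : forall m, (gamma ci.-1 <= m)%N -> G m by rewrite e ltnn.
move=> m; rewrite leq_eqVlt => /orP[/eqP<-|hm]; first exact: enum_in.
by apply: h1; rewrite e.
Qed.

Lemma enum1_gt1 : (1 < gamma 1)%N.
Proof.
rewrite ltnNge; apply/negP => h; have e : gamma 1 = 1%N.
  by apply/eqP; rewrite eqn_leq h -{1}enum0 enum_lt.
case: hsing => m; have -> // : G m.
have [G0 GD _] := hG; elim: m => // m IH.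
by rewrite -addn1; apply: GD => //; rewrite -e; apply: enum_in.
Qed.

End SemigroupSequence.

Section WorstWeight.
Variables (gamma : nat -> nat) (ci : nat).
Hypothesis gamma_lt : forall i, (gamma i < gamma i.+1)%N.
Hypothesis gamma0 : gamma 0 = 0%N.
Hypothesis gamma1 : (1 < gamma 1)%N.
Hypothesis gamma_tail : forall i, (ci <= i)%N -> gamma i.+1 = (gamma i).+1.
Hypothesis ci_gt0 : (0 < ci)%N.

Variables (l : nat) (s : nat -> rat).
Let r i := \sum_(j < l.+1) s j * hinge rat gamma j i - (excess gamma i)%:R.
Hypothesis ci_lt_l : (ci < l)%N.
Hypothesis csum_l : csum r l = 0.
Hypothesis tsum_l : tsum gamma r l = 0.
Hypothesis kkt : forall j, (j <= l)%N ->
  [/\ 0 <= s j, 0 <= tsum gamma r j & s j * tsum gamma r j = 0].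

Variable N : nat.
Hypothesis lN : (l < N)%N.
Hypothesis large : 2 / (N%:R - l%:R + 1) <= s l.

Let N_gt0 : (0 < N)%N. Proof. exact: leq_ltn_trans lN. Qed.
Let ciN : (ci < N)%N. Proof. exact: ltn_trans lN. Qed.

Local Notation w := (worst_coord gamma l s N).
Local Notation a i := ((avec gamma N i.+1)%:R : rat).
Local Notation g i := ((gamma i)%:R : rat).
Local Notation hinge := (hinge rat gamma).
Local Notation choice_fun := {ffun 'I_(gamma N).*2 -> 'I_N.+1}.

Lemma sum_avec_worst : \sum_(i < N.+1) a i * w i = \sum_(i < N.+1) w i ^+ 2.
Proof.
apply/eqP; rewrite eq_sym -subr_eq0 -sumrB; apply/eqP.
rewrite -[RHS](residual_orthogonal gamma_lt gamma0 gamma1 gamma_tail ci_lt_l csum_l tsum_l kkt lN large).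
by apply: eq_bigr => i _; ring.
Qed.

Lemma choice_sum1 (lam : choice_fun) : \sum_(i < (gamma N).*2) (1 : rat) = 2 * g N.
Proof. by rewrite sumr_const card_ord -mul2n natrM. Qed.

Lemma choice_sum_gamma (lam : choice_fun) : admissible (gamma := gamma) lam ->
  \sum_(i < (gamma N).*2) g (lam i) = g N ^+ 2.
Proof. by move/admissible_sum => h; rewrite -natr_sum h natrX. Qed.

Lemma choice_sum_hinge (lam : choice_fun) j : admissible (gamma := gamma) lam -> (j <= N)%N ->
  g j ^+ 2 <= \sum_(i < (gamma N).*2) hinge j (lam i)
  /\ ((forall i, tight (gamma := gamma) lam (gamma j) i) ->
      g j ^+ 2 = \sum_(i < (gamma N).*2) hinge j (lam i)).
Proof.
move=> adm jN; rewrite /hinge -natr_sum -natrX ler_nat.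
have [h1 h2] := admissible_hinge gamma_lt gamma0 N_gt0 adm (gamma_le gamma_lt jN).
split=> // t; congr (_%:R); apply/eqP; rewrite h2; exact/forallP.
Qed.

(** This gives mu(F, w) >= |w|^2. The choice [lam] and the vector a have equal mass and first
    moment, the hinge moments of [lam] are at least those of a, and w has nonnegative hinge
    coefficients. *)
Lemma worst_choice_ge (lam : choice_fun) : admissible (gamma := gamma) lam ->
  \sum_(i < N.+1) w i ^+ 2 <= \sum_(i < (gamma N).*2) w (lam i).
Proof.
move=> adm; rewrite -sum_avec_worst.
have [A [B wE]] : exists A B, forall i, (i <= N)%N ->
    w i = A + B * g i + \sum_(j < l.+1) hinge_coef l s N j * hinge j i.
  by do 2 eexists; exact: (worst_coordE gamma_lt gamma0 gamma1 gamma_tail ci_lt_l lN large).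
have sumE (I : finType) (c : I -> rat) (f : I -> nat) : (forall i, f i <= N)%N ->
   \sum_i c i * w (f i) = A * (\sum_i c i) + B * (\sum_i c i * g (f i))
     + \sum_(j < l.+1) hinge_coef l s N j * \sum_i c i * hinge j (f i).
  move=> hf; under [X in _ + X]eq_bigr => j _ do rewrite mulr_sumr.
  rewrite exchange_big /= !mulr_sumr -!big_split /=; apply: eq_bigr => i _.
  rewrite wE // 2!mulrDr mulr_sumr; congr (_ + _ + _); [by ring|by ring|].
  by apply: eq_bigr => j _; ring.
rewrite (sumE _ (fun i : 'I_N.+1 => a i) (fun i => i)); last by move=> i; rewrite -ltnS.
rewrite (sum_avec rat gamma_lt gamma0 gamma_tail ciN) (sum_avec_gamma rat gamma_lt gamma0 gamma_tail ciN).
have -> : \sum_(i < (gamma N).*2) w (lam i) = \sum_(i < (gamma N).*2) 1 * w (lam i).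
  by apply: eq_bigr => i _; rewrite mul1r.
rewrite (sumE _ (fun=> 1) (fun i => lam i)); last by move=> i; rewrite -ltnS.
rewrite (choice_sum1 lam).
have -> : \sum_(i < (gamma N).*2) 1 * g (lam i) = g N ^+ 2.
  by rewrite -(choice_sum_gamma adm); apply: eq_bigr => i _; rewrite mul1r.
rewrite lerD2l; apply: ler_sum => j _.
have jl : (j <= l)%N by rewrite -ltnS.
apply: ler_wpM2l; first exact: (hinge_coef_ge0 ci_lt_l kkt lN large jl).
have jN : (j <= N)%N by apply: leq_trans jl (ltnW lN).
rewrite sum_avec_hinge //; have [h _] := choice_sum_hinge adm jN.
by under [leRHS]eq_bigr => i _ do rewrite mul1r.
Qed.

Variables (k : closedFieldType) (F : {mpoly k[2 * N.+1]}).
Hypothesis hF : is_chow_form (monomial_curve k gamma N) F.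

Let F_resx : exists2 c : k, c != 0 & F = c *: resx gamma (coef_mx k N.+1).
Proof.
have [_ F_irr F_zero] := hF.
apply: (chow_form_resx gamma_lt gamma0 _ _ F_irr) => [||A x rA h].
- by apply: leq_ltn_trans ciN.
- by rewrite -gamma_tail ?prednK // -ltnS prednK.
apply/(F_zero A rA); exists (monomial_point gamma N x).
  split=> [|d p _ hp]; last exact: hp.
  by apply/eqP => /matrixP/(_ ord0 0)/eqP; rewrite !mxE gamma0 expr0 oner_eq0.
apply/matrixP => e j; rewrite !mxE -[RHS](h e).
by apply: eq_bigr => i _; rewrite mxE.
Qed.

(* Any v is compared on the vertices of its lower convex hull h. *)
Lemma hilbert_mumford_le_worst (v : 'rV[int]_N.+1) m :
  hilbert_mumford F (diag_ps v) m -> m%:~R <= \sum_(i < N.+1) w i * (v 0 i)%:~R.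
Proof.
move=> hm; have [c c0 defF] := F_resx.
pose u i : rat := (v 0 (inord i))%:~R.
have uE (i : 'I_N.+1) : u i = (v 0 i)%:~R by rewrite /u inord_val.
have [h [h0 hN hu hconv _]] := convex_minorant gamma_lt gamma0 u (leq0n N).
(* The contact set of u with its convex minorant; it contains every point where the slope of h
   jumps. *)
pose B := [set i : 'I_N.+1 | h i == u i].
have B0 : ord0 \in B by rewrite inE h0.
have BN : ord_max \in B by rewrite inE hN.
have := hilbert_mumford_le gamma_lt gamma0 N_gt0 c0 defF B0 BN hm.
have adm := chain_fun_admissible gamma_lt gamma0 B0 BN.
rewrite -(ler_int rat) => /le_trans; apply.
have -> : (choice_weight v (chain_fun gamma B))%:~R
    = \sum_(i < (gamma N).*2) 1 * h (chain_fun gamma B i).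
  rewrite rmorph_sum; apply: eq_bigr => i _ /=; rewrite mul1r -uE.
  have /andP[] := chain_fun_odd gamma_lt gamma0 B0 BN i.
  by rewrite inE => /eqP->.
have NE : N = N.-1.+1 by rewrite prednK.
have decomp (I : finType) (c' : I -> rat) (f : I -> nat) : (forall i, f i <= N)%N ->
   \sum_i c' i * h (f i) = (h N - slope gamma h N.-1 * g N) * (\sum_i c' i)
     + slope gamma h N.-1 * (\sum_i c' i * g (f i))
     + \sum_(j < N) (slope gamma h j - slope gamma h j.-1) * \sum_i c' i * hinge j (f i).
  move=> hf; have := @sum_hinge_decomposition _ _ gamma_lt I c' f h N.-1.
  by rewrite -NE; apply.
(* Mass and first moment agree. At each jump of slope the chain is tight, so that hinge moment
   agrees too; elsewhere the coefficient is 0. *)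
have -> : \sum_(i < (gamma N).*2) 1 * h (chain_fun gamma B i) = \sum_(i < N.+1) a i * h i.
  rewrite decomp => [|i]; last by rewrite -ltnS.
  rewrite (decomp _ (fun i : 'I_N.+1 => a i) (fun i => i)) => [|i]; last by rewrite -ltnS.
  rewrite (choice_sum1 (chain_fun gamma B)) (sum_avec rat gamma_lt gamma0 gamma_tail ciN).
  rewrite (sum_avec_gamma rat gamma_lt gamma0 gamma_tail ciN).
  have -> : \sum_(i < (gamma N).*2) 1 * g (chain_fun gamma B i) = g N ^+ 2.
    by rewrite -(choice_sum_gamma adm); apply: eq_bigr => i _; rewrite mul1r.
  congr (_ + _); apply: eq_bigr => j _.
  have jN : (j <= N)%N by apply: ltnW.
  rewrite sum_avec_hinge //.
  under eq_bigr => i _ do rewrite mul1r.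
  have [j0|j_gt0] := posnP j; first by rewrite j0 subrr !mul0r.
  have [le_s lt_s] := hconv j ltac:(by rewrite j_gt0 ltn_ord).
  move: le_s; rewrite le_eqVlt => /orP[/eqP->|/lt_s hj]; first by rewrite subrr !mul0r.
  congr (_ * _); symmetry; apply: (choice_sum_hinge adm jN).2 => i.
  have jB : widen_ord (leqnSn N) j \in B by rewrite inE hj.
  exact: (chain_fun_tight gamma_lt gamma0 B0 BN i jB).
(* The residual w - a kills affine functions and has nonnegative hinge moments, so it pairs
   nonnegatively with the convex h. *)
apply: (@le_trans _ _ (\sum_(i < N.+1) w i * h i)).
  rewrite -subr_ge0 -sumrB.
  rewrite (eq_bigr (fun i : 'I_N.+1 => (w i - a i) * h i)) => [|i _]; last by rewrite mulrBl.
  rewrite (decomp _ (fun i : 'I_N.+1 => w i - a i) (fun i => i)) => [|i]; last by rewrite -ltnS.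
  rewrite (sum_residual gamma_lt gamma0 gamma1 gamma_tail ci_lt_l csum_l lN large).
  rewrite (sum_residual_gamma gamma_lt gamma0 gamma1 gamma_tail ci_lt_l csum_l tsum_l lN large).
  rewrite !mulr0 !add0r; apply: sumr_ge0 => j _.
  have [j0|j_gt0] := posnP j; first by rewrite j0 subrr mul0r.
  have [le_s _] := hconv j ltac:(by rewrite j_gt0 ltn_ord).
  apply: mulr_ge0; first by rewrite subr_ge0.
  by apply: (sum_residual_hinge gamma_lt gamma0 gamma1 gamma_tail ci_lt_l csum_l tsum_l kkt lN large); apply: ltnW.
apply: ler_sum => i _; rewrite -uE; apply: ler_wpM2l.
  by apply: (worst_coord_ge0 kkt lN); rewrite -ltnS.
by apply: hu; rewrite /= -ltnS.
Qed.

(** Testing the supremum rho on K w gives rho >= |w|, while rho |v| = mu(F, v) <= <w, v>. This is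
    equality in Cauchy-Schwarz, so v is proportional to w. *)
Lemma worst_weightE (R : realType) (x : 'rV[R]_N.+1) :
  worst_weight F x ->
  \sum_(i < N.+1) (avec gamma N i.+1)%:R * x 0 i = vnorm x ^+ 2 ->
  forall i : 'I_N.+1, x 0 i = ratr (w i).
Proof.
move=> [v [t [[rho [_ _ v_neq0 [m hm rhoE]] [rho_ub _]] t_gt0 xE]]] scale.
have [c c0 defF] := F_resx.
pose wR i : R := ratr (w i).
have [K [z [K_gt0 zE]]] := common_denominator (fun i : 'I_N.+1 => w i).
pose v0 : 'rV[int]_N.+1 := \row_i z i.
have v0E i : (v0 0 i)%:~R = K%:R * wR i :> R.
  by rewrite mxE -ratr_int zE rmorphM /= ratr_nat.
pose W := \sum_(i < N.+1) wR i ^+ 2.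
have WE : W = ratr (\sum_(i < N.+1) w i ^+ 2).
  by rewrite rmorph_sum; apply: eq_bigr => i _; rewrite rmorphXn.
have w0_gt0 : 0 < wR 0%N.
  rewrite ltr0q /worst_coord (leq_ltn_trans _ ci_lt_l) //.
  apply: ltr_pwDl => //; apply: sumr_ge0 => j _.
  by rewrite mulr_ge0 ?hinge_ge0 //; case: (kkt (ltn_ord j : (j <= l)%N)).
have W_gt0 : 0 < W.
  rewrite /W (bigD1 ord0) //=; apply: ltr_pwDl; first by rewrite exprn_gt0.
  by apply: sumr_ge0 => i _; apply: sqr_ge0.
have K_gt0' : 0 < K%:R :> R by rewrite ltr0n.
have v0_neq0 : v0 != 0.
  apply/eqP => /matrixP/(_ 0 ord0) e; have := v0E ord0; rewrite e mxE => /esym/eqP.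
  by rewrite mulf_eq0 !gt_eqF.
have norm_v0 : vnorm (map_mx intr v0) = K%:R * Num.sqrt W :> R.
  rewrite /vnorm -[K%:R]ger0_norm ?ler0n // -sqrtr_sqr -sqrtrM ?sqr_ge0 //.
  congr Num.sqrt; rewrite /W mulr_sumr; apply: eq_bigr => i _.
  by rewrite mxE v0E exprMn.
have [m0 hm0] := hilbert_mumford_exists gamma_lt gamma0 c0 defF v0.
have m0_ge : K%:R * W <= m0%:~R.
  have [lam adm ->] := hilbert_mumford_choice defF hm0.
  rewrite rmorph_sum /= (eq_bigr (fun i : 'I_(gamma N).*2 => K%:R * wR (lam i))); last first.
    by move=> i _; rewrite v0E.
  rewrite -mulr_sumr ler_pM2l // WE -rmorph_sum /= ler_rat.
  exact: worst_choice_ge.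
have rho_ge : Num.sqrt W <= rho.
  apply: (@le_trans _ _ (m0%:~R / vnorm (map_mx intr v0))); last first.
    apply: rho_ub; exists (diag_ps v0), v0; split=> //; last by exists m0.
      exact: one_ps_diag.
    exact: conj_diag_diag.
  rewrite ler_pdivlMr norm_v0; last by rewrite mulr_gt0 ?sqrtr_gt0.
  rewrite mulrCA -expr2 sqr_sqrtr ?(ltW W_gt0) //.
pose V := \sum_(i < N.+1) (v 0 i)%:~R ^+ 2 : R.
have normv : vnorm (map_mx intr v) = Num.sqrt V.
  by rewrite /vnorm; congr Num.sqrt; apply: eq_bigr => i _; rewrite mxE.
have V_gt0 : 0 < V.
  have [i vi] : exists i, v 0 i != 0.
    apply/existsP; apply: contraNT v_neq0 => /existsPn h; apply/eqP/matrixP => i j.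
    by rewrite mxE ord1; apply/eqP; have := h j; rewrite negbK.
  rewrite /V (bigD1 i) //=; apply: ltr_pwDl.
    by rewrite exprn_even_gt0 //= intr_eq0.
  by apply: sumr_ge0 => j _; apply: sqr_ge0.
have cs := @cauchy_schwarz_eq R _ (fun i : 'I_N.+1 => wR i) (fun i => (v 0 i)%:~R) _.
have {}cs i : (v 0 i)%:~R * Num.sqrt W = wR i * Num.sqrt V.
  apply: cs; rewrite -/W -/V.
  apply: (@le_trans _ _ m%:~R).
    by rewrite -ler_pdivlMr ?sqrtr_gt0 // -normv -rhoE.
  have := hilbert_mumford_le_worst hm; rewrite -(ler_rat R) ratr_int rmorph_sum /= => /le_trans; apply.
  by apply: ler_sum => i' _; rewrite rmorphM /= ratr_int.
pose q := t * (Num.sqrt V / Num.sqrt W).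
have sW0 : Num.sqrt W != 0 by rewrite gt_eqF ?sqrtr_gt0.
have q_gt0 : 0 < q by rewrite mulr_gt0 ?divr_gt0 ?sqrtr_gt0.
have xq i : x 0 i = q * wR i.
  rewrite xE !mxE /q -mulrA; congr (_ * _).
  by apply: (mulIf sW0); rewrite cs; field.
(* The scaling condition reads q <a, w> = q^2 |w|^2, and <a, w> = |w|^2. *)
have q1 : q = 1.
  have : q * W = q ^+ 2 * W.
    move: scale; rewrite /vnorm sqr_sqrtr; last by apply: sumr_ge0 => i _; apply: sqr_ge0.
    rewrite (eq_bigr (fun i : 'I_N.+1 => q * ratr (a i * w i))); last first.
      by move=> i _; rewrite xq rmorphM /= ratr_nat; ring.
    rewrite -mulr_sumr -rmorph_sum /= sum_avec_worst -WE => ->.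
    by rewrite /W mulr_sumr; apply: eq_bigr => i _; rewrite xq exprMn.
  rewrite expr2 -mulrA => /(mulfI (lt0r_neq0 q_gt0)) e.
  by apply: (mulIf (lt0r_neq0 W_gt0)); rewrite mul1r -e.
by move=> i; rewrite xq q1 mul1r.
Qed.

End WorstWeight.

Theorem mainTheorem1 (R : realType) (G : pred nat) (gamma : nat -> nat)
    (ci : nat) (hG : numerical_semigroup G) (hsing : exists n, ~~ G n)
    (hgamma : enumerates G gamma) (hci : is_conductor G (gamma ci)) :
  exists (N0 l : nat) (c : nat -> R), (l <= N0)%N /\
    forall N : nat, (ci < N)%N -> (N0 <= N)%N ->
    forall (k : closedFieldType) (F : {mpoly k[2 * N.+1]}) (w : 'rV[R]_N.+1),
      is_chow_form (monomial_curve k gamma N) F ->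
      worst_weight F w ->
      \sum_(i < N.+1) (avec gamma N i.+1)%:R * w 0 i = vnorm w ^+ 2 ->
      let D := (N%:R - l%:R + 1) * (N%:R - l%:R + 2) in
      let m := - (6 / D) in
      let b := 2 + 2 * (N%:R + 2 * l%:R - 1) / D in
      (forall i : 'I_N.+1, (i < l)%N -> w 0 i = c i) /\
      (forall i : 'I_N.+1, (l <= i)%N -> w 0 i = m * i%:R + b).
Proof.
have gamma_lt := enum_lt hgamma.
have gamma0 := enum0 hG hgamma.
have gamma1 := enum1_gt1 hG hsing hgamma.
have gamma_tail := enum_tail hgamma hci.
have ci_gt0 := conductor_index_gt0 hG hsing hgamma hci.
have gap := enum_gap hG hsing hgamma hci.
have [l [s [ci_l s_l csum_l tsum_l kkt]]] :=
  limit_projection rat gamma_lt gamma0 gamma1 gamma_tail ci_gt0 gap.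
(* The numerator of a nonnegative rational is an integer upper bound for it. N0 = l + K + 1 then
   makes 2 / (N - l + 1) at most [s l]. *)
pose K := absz (numq (2 / s l)).
have hK : 2 / s l <= K%:R.
  have p : 0 <= 2 / s l by rewrite divr_ge0 // ltW.
  rewrite -[leLHS]divq_num_den /K [leRHS]pmulrn gez0_abs ?numq_ge0 //.
  rewrite ler_pdivrMr ?ltr0z ?denq_gt0 // ler_peMr ?ler0z ?numq_ge0 //.
  by rewrite ler1z -gtz0_ge1 denq_gt0.
exists (l + K).+1, l, (fun i => ratr (2 + \sum_(j < l.+1) s j * hinge rat gamma j i)).
split=> [|N ciN N0N k F w hF hw hscale D m b]; first by rewrite leqW ?leq_addr.
have lN : (l < N)%N by apply: leq_trans N0N; rewrite ltnS leq_addr.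
have T_ge : K%:R + 1 <= N%:R - l%:R :> rat.
  by rewrite lerBrDr natr1 -natrD ler_nat; move: N0N; clear; lia.
have large : 2 / (N%:R - l%:R + 1) <= s l.
  have Tp : 0 < N%:R - l%:R + 1 :> rat by have := ler0n rat K; move: T_ge; lra.
  rewrite ler_pdivrMr // mulrC -ler_pdivrMr //.
  by apply: le_trans hK _; move: T_ge; lra.
have wE := worst_weightE gamma_lt gamma0 gamma1 gamma_tail ci_gt0 ci_l csum_l tsum_l kkt lN large hF hw hscale.
split=> i il; rewrite wE /worst_coord; first by rewrite il.
rewrite ltnNge il /= /tail_line.
rewrite !(rmorphD, rmorphM, rmorphB, fmorphV, rmorphN, rmorph1, ratr_nat) /= /m /b /D.
have : l%:R + 1 <= N%:R :> R by rewrite natr1 ler_nat.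
move=> h; field; apply/andP; split; apply: lt0r_neq0; lra.
Qed.
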